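(* Let $X,Y$ be Banach spaces, $T:X\to Y$ a continuous linear operator, and $1\leq p<\infty$. Then: (i) $\widehat{T^{*}}:\ell_{p^{*}}(Y^{*})\to (\ell_{p}^{mid})^{dual}(X^{*})$, $(f_j)_j\mapsto (T^*f_j)_j$, is well defined and continuous if and only if $T\in \Pi_{p}^{mid}(X,Y)$. In this case, $\pi_{p}^{mid}(T)=\|\widehat{T^{*}}\|$. (ii) $\hat{T}:\ell_{p^{*}}(X)\to(\ell_{p}^{mid})^{dual}(Y)$, $(x_j)_j\mapsto(Tx_j)_j$, is well defined and continuous if and only if $T^{*}\in \Pi_{p}^{mid}(Y^{*},X^{*})$. Moreover, $\pi_{p}^{mid}(T^{*})=\|\hat{T}\|$.
   Context: $Z$ denotes a Banach space over $\mathbb{K}$ ($=\mathbb{R}$ or $\mathbb{C}$), $Z^{*}$ its topological dual, $B_Z$ its closed unit ball; $T^*$ is the adjoint of $T$. $p^{*}$ is the conjugate exponent of $p$ ($1/p+1/p^*=1$). Sequence spaces. For $1\le q<\infty$: $\ell_q(Z)$ is the space of sequences in $Z$ with $\|(z_j)_j\|_q=(\sum_j\|z_j\|^q)^{1/q}<\infty$, and $\ell_\infty(Z)$ is the space of bounded sequences with the sup norm. For $1\le p<\infty$: $\ell_p^w(Z)$ is the space of sequences with $\|(z_j)_j\|_p^w=\sup_{z^*\in B_{Z^*}}(\sum_j|z^*(z_j)|^p)^{1/p}<\infty$; $\ell_p^{mid}(Z)$ is the space of sequences $(z_j)_j$ in $Z$ such that $\sum_n\sum_j|z_n^*(z_j)|^p<\infty$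 for every $(z_n^* )_n\in\ell_p^w(Z^* )$, with norm $\|(z_j)_j\|_p^{mid}=\sup_{(z_n^* )_n\in B_{\ell_p^w(Z^* )}}(\sum_n\sum_j|z_n^*(z_j)|^p)^{1/p}$; $(\ell_p^{mid})^{dual}(Z)$ is the space of sequences $(z_j)_j$ in $Z$ with $\sum_j|z_j^*(z_j)|<\infty$ for all $(z_j^* )_j\in\ell_p^{mid}(Z^* )$, with norm $\|(z_j)_j\|_{p,mid}^{dual}=\sup_{(z_j^* )_j\in B_{\ell_p^{mid}(Z^* )}}\sum_j|z_j^*(z_j)|$. A linear operator $R:X\to Y$ is absolutely mid $p$-summing, $R\in\Pi_p^{mid}(X,Y)$, if $\ell_p^{mid}(X)\to\ell_p(Y)$, $(x_j)_j\mapsto(Rx_j)_j$, is well defined and continuous; $\pi_p^{mid}(R)$ is the norm of this map. *)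

(* Defs.v *)
From HB Require Import structures.
From mathcomp Require Import all_boot all_order all_algebra.
From mathcomp Require Import all_classical all_reals all_analysis.
From mathcomp Require Import complex.
Import Order.TTheory GRing.Theory Num.Theory.
Import numFieldNormedType.Exports.

Set Implicit Arguments.
Unset Strict Implicit.
Unset Printing Implicit Defensive.

Local Open Scope classical_set_scope.
Local Open Scope ring_scope.

Variant base_field := RealField | ComplexField.

Definition scalars (R : realType) (k : base_field) : numFieldType :=
  match k with RealField => R | ComplexField => R[i] end.

Definition to_scalars {R : realType} {k : base_field} : R -> scalars R k :=
  match k with RealField => fun r => r | ComplexField => fun r => r%:C%C end.

Definition scalars_re {R : realType} {k : base_field} : scalars R k -> R :=
  match k with RealField => fun r => r | ComplexField => fun z => complex.Re z end.

(* In the library the norm of a normed K-space is K-valued (a nonnegative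
   element of K); [rnorm] is the same norm seen as a real number. *)
Definition rnorm {R : realType} {k : base_field}
  {V : normedModType (scalars R k)} (v : V) : R := scalars_re `|v|.

Section rnorm_theory.
Context {R : realType} {k : base_field}.
Notation K := (scalars R k).

Lemma to_scalarsK : cancel (@to_scalars R k) scalars_re.
Proof. by case: k. Qed.

Lemma to_scalarsD (x y : R) : to_scalars (x + y) = to_scalars x + to_scalars y :> K.
Proof. by case: k => //=; rewrite rmorphD. Qed.

Lemma to_scalarsM (x y : R) : to_scalars (x * y) = to_scalars x * to_scalars y :> K.
Proof. by case: k => //=; rewrite rmorphM. Qed.

Lemma to_scalars0 : to_scalars 0 = 0 :> K.
Proof. by case: k. Qed.

Lemma to_scalars1 : to_scalars 1 = 1 :> K.
Proof. by case: k. Qed.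

Lemma ler_to_scalars (x y : R) : (to_scalars x <= to_scalars y :> K) = (x <= y).
Proof. by case: k => //=; rewrite lecR. Qed.

Lemma scalars_reK (x : K) : 0 <= x -> to_scalars (scalars_re x) = x.
Proof.
case: k x => //= -[a b]; rewrite lecE /= => /andP[/eqP b0 _].
by rewrite b0.
Qed.

Lemma rnormK (V : normedModType K) (v : V) : to_scalars (rnorm v) = `|v|.
Proof. exact: scalars_reK. Qed.

Lemma rnorm_ge0 (V : normedModType K) (v : V) : 0 <= rnorm v.
Proof. by rewrite -ler_to_scalars rnormK to_scalars0. Qed.

Lemma rnormD (V : normedModType K) (u v : V) : rnorm (u + v) <= rnorm u + rnorm v.
Proof. by rewrite -ler_to_scalars to_scalarsD !rnormK ler_normD. Qed.

Lemma rnormZ (V : normedModType K) (a : K) (v : V) :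
  rnorm (a *: v) = rnorm (a : K^o) * rnorm v.
Proof.
by apply: (can_inj to_scalarsK); rewrite to_scalarsM !rnormK normrZ.
Qed.

Lemma rnorm0 (V : normedModType K) : rnorm (0 : V) = 0.
Proof.
by apply: (can_inj to_scalarsK); rewrite rnormK to_scalars0 normr0.
Qed.

Lemma rnorm0_eq0 (V : normedModType K) (v : V) : rnorm v = 0 -> v = 0.
Proof. by move=> v0; apply: normr0_eq0; rewrite -rnormK v0 to_scalars0. Qed.

End rnorm_theory.

Definition dual_pred {R : realType} {k : base_field}
    (V : normedModType (scalars R k)) : {pred V -> (scalars R k)^o} :=
  mem [set f : V -> (scalars R k)^o | linear f /\ continuous f].
Arguments dual_pred {R k} V _.

Record dual {R : realType} {k : base_field} (V : normedModType (scalars R k)) :=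
  Dual { dual_fun :> V -> (scalars R k)^o ; dual_funP : dual_fun \in dual_pred V }.

Section dual_lmodule.
Context {R : realType} {k : base_field} (V : normedModType (scalars R k)).
Notation K := (scalars R k).

HB.instance Definition _ := [isSub for @dual_fun R k V].
HB.instance Definition _ := [Choice of dual V by <:].

Lemma dual_predP (f : V -> K^o) :
  reflect (linear f /\ continuous f) (f \in dual_pred V).
Proof. by apply: (iffP idP) => [/set_mem|/mem_set]. Qed.

Lemma dual_submod_closed : submod_closed (dual_pred V).
Proof.
split.
  apply/dual_predP; split; first by move=> a x y; rewrite scaler0 addr0.
  by move=> x; exact: cvg_cst.
move=> a f g /dual_predP[lf cf] /dual_predP[lg cg]; apply/dual_predP; split.
  move=> b x y /=.
  rewrite !fctE lf lg !scalerDr !scalerA (mulrC a b) -!addrA; congr (_ + _).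
  by rewrite addrCA.
by move=> x; apply: cvgD; [apply: cvgZr; exact: cf|exact: cg].
Qed.

HB.instance Definition _ :=
  GRing.isSubmodClosed.Build _ _ (dual_pred V) dual_submod_closed.
HB.instance Definition _ := [SubChoice_isSubLmodule of dual V by <:].

Lemma dual_is_linear (f : dual V) : linear (f : V -> K^o).
Proof. by have /dual_predP[] := dual_funP f. Qed.

Lemma dual_continuous (f : dual V) : continuous (f : V -> K^o).
Proof. by have /dual_predP[] := dual_funP f. Qed.

HB.instance Definition _ (f : dual V) :=
  GRing.isLinear.Build K V K^o _ (f : V -> K^o) (@dual_is_linear f).

Definition dual_norm (f : dual V) : R :=
  sup [set rnorm (f x) | x in [set x : V | rnorm x <= 1]].

Lemma dual_norm_has_sup (f : dual V) :
  has_sup [set rnorm (f x) | x in [set x : V | rnorm x <= 1]].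
Proof.
split; first by exists (rnorm (f 0)), 0 => //=; rewrite rnorm0.
have /linear_boundedP := (continuous_linear_bounded 0 (@dual_continuous f 0)).
move=> /pinfty_ex_gt0[M M0 fM].
exists (scalars_re M) => _ [x /= x1 <-].
rewrite -(@ler_to_scalars R k) rnormK scalars_reK ?(ltW M0)//.
apply: (le_trans (fM x)); rewrite ger_pMr// -rnormK.
by rewrite -(@to_scalars1 R k) ler_to_scalars.
Qed.

Lemma dual_norm_ub (f : dual V) (x : V) : rnorm (f x) <= dual_norm f * rnorm x.
Proof.
have [->|x0] := eqVneq x 0; first by rewrite linear0 !rnorm0 mulr0.
have nx0 : 0 < rnorm x.
  by rewrite lt_neqAle rnorm_ge0 andbT eq_sym; apply: contra x0 => /eqP/rnorm0_eq0->.
have rV : rnorm (to_scalars (rnorm x)^-1 : K^o) = (rnorm x)^-1.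
  rewrite /rnorm ger0_norm ?to_scalarsK// -(@to_scalars0 R k) ler_to_scalars.
  by rewrite invr_ge0 ltW.
rewrite -ler_pdivrMr// mulrC -rV -rnormZ -linearZ.
apply: (ub_le_sup (proj2 (dual_norm_has_sup f))); exists (to_scalars (rnorm x)^-1 *: x) => //=.
by rewrite rnormZ rV mulVf// gt_eqF.
Qed.

Lemma dual_norm_le (f : dual V) (c : R) :
  (forall x : V, rnorm x <= 1 -> rnorm (f x) <= c) -> dual_norm f <= c.
Proof.
move=> fc; apply: ge_sup; first exact: (proj1 (dual_norm_has_sup f)).
by move=> _ [x /= x1 <-]; exact: fc.
Qed.

Lemma dual_norm_ge0 (f : dual V) : 0 <= dual_norm f.
Proof.
apply: le_trans (rnorm_ge0 (f 0)) _.
by apply: (ub_le_sup (proj2 (dual_norm_has_sup f))); exists 0 => //=; rewrite rnorm0.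
Qed.

Let norm (f : dual V) : K := to_scalars (dual_norm f).

Let dual_ler_normD (f g : dual V) : norm (f + g) <= norm f + norm g.
Proof.
rewrite /norm -to_scalarsD ler_to_scalars; apply: dual_norm_le => x x1.
apply: (le_trans (rnormD _ _)); apply: lerD;
  by apply: (ub_le_sup (proj2 (dual_norm_has_sup _))); exists x.
Qed.

Let dual_normZ_le (a : K) (f : dual V) :
  dual_norm (a *: f) <= rnorm (a : K^o) * dual_norm f.
Proof.
apply: dual_norm_le => x x1.
have -> : (a *: f) x = a *: (f x) by [].
rewrite rnormZ ler_wpM2l ?rnorm_ge0//.
by apply: (ub_le_sup (proj2 (dual_norm_has_sup _))); exists x.
Qed.

Let dual_normZ (a : K) (f : dual V) : norm (a *: f) = `|a| * norm f.
Proof.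
rewrite /norm -(@rnormK R k K^o) -to_scalarsM; congr to_scalars.
apply/eqP; rewrite eq_le dual_normZ_le/=.
have [->|a0] := eqVneq a 0; first by rewrite rnorm0 mul0r dual_norm_ge0.
have a'0 : 0 < rnorm (a : K^o).
  rewrite lt_neqAle rnorm_ge0 andbT eq_sym.
  by apply: contra a0 => /eqP/rnorm0_eq0->.
rewrite -ler_pdivlMl// -{1}[f](scalerK a0).
apply: (le_trans (dual_normZ_le _ _)); rewrite ler_wpM2r ?dual_norm_ge0//.
rewrite -[leLHS](mulKf (lt0r_neq0 a'0)) -rnormZ /GRing.scale/= divff//.
by rewrite /rnorm normr1 -(@to_scalars1 R k) to_scalarsK mulr1.
Qed.

Let dual_norm_eq0 (f : dual V) : norm f = 0 -> f = 0.
Proof.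
rewrite /norm -to_scalars0 => /(can_inj to_scalarsK) f0.
apply/val_inj/funext => x /=; apply: rnorm0_eq0; apply/eqP.
by rewrite eq_le rnorm_ge0 andbT (le_trans (dual_norm_ub f x))// f0 mul0r.
Qed.

HB.instance Definition _ := Lmodule_isNormed.Build K (dual V)
  dual_ler_normD dual_normZ dual_norm_eq0.

Lemma rnorm_dual (f : dual V) : rnorm f = dual_norm f.
Proof. exact: to_scalarsK. Qed.

End dual_lmodule.

Section adjoint.
Context {R : realType} {k : base_field} {X Y : normedModType (scalars R k)}.
Variables (T : {linear X -> Y}) (cT : continuous T).
Notation K := (scalars R k).

Lemma adjoint_subproof (f : dual Y) : (f \o T : X -> K^o) \in dual_pred X.
Proof.
apply/dual_predP; split; first by move=> a x y /=; rewrite !linearP.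
by move=> x; apply: continuous_comp; [exact: cT|exact: dual_continuous].
Qed.

Definition adjoint (f : dual Y) : dual X := Dual (adjoint_subproof f).

Lemma adjoint_is_linear : linear adjoint.
Proof. by move=> a f g; exact/val_inj. Qed.

HB.instance Definition _ :=
  GRing.isLinear.Build K (dual Y) (dual X) _ adjoint adjoint_is_linear.

End adjoint.

(* The norm is given on all sequences, with value +oo allowed. *)
Record seq_space {R : realType} {k : base_field}
    (V : normedModType (scalars R k)) := SeqSpace {
  seq_carrier :> V^nat -> Prop ;
  seq_norm : V^nat -> \bar R }.

Definition seq_ball {R : realType} {k : base_field}
    {V : normedModType (scalars R k)} (S : seq_space V) : set (V^nat) :=
  [set z | S z /\ (seq_norm S z <= 1)%E].

Section sequence_spaces.
Context {R : realType} {k : base_field}.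
Local Open Scope ereal_scope.
Implicit Type V : normedModType (scalars R k).

(* For the counting measure on nat, the L^q-norm is the l_q-norm when q is
   finite and the supremum norm when q = +oo. *)
Definition ell_norm (q : \bar R) V (z : V^nat) : \bar R :=
  'N[counting]_q[(fun j => (rnorm (z j))%:E)].

Definition ell (q : \bar R) V : seq_space V :=
  SeqSpace [set z | ell_norm q z < +oo] (@ell_norm q V).

Definition ell_weak_norm (p : R) V (z : V^nat) : \bar R :=
  ereal_sup [set (\sum_(j <oo) ((rnorm (f (z j))) `^ p)%:E) `^ p^-1
            | f in [set f : dual V | (rnorm f <= 1)%R]].

Definition ell_weak (p : R) V : seq_space V :=
  SeqSpace [set z | ell_weak_norm p z < +oo] (@ell_weak_norm p V).

Definition mid_sum (p : R) V (z : V^nat) (f : (dual V)^nat) : \bar R :=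
  \sum_(n <oo) \sum_(j <oo) ((rnorm (f n (z j))) `^ p)%:E.

Definition ell_mid (p : R) V : seq_space V :=
  SeqSpace
    [set z | forall f, ell_weak p (dual V) f -> mid_sum p z f < +oo]
    (fun z => ereal_sup [set mid_sum p z f `^ p^-1
                        | f in seq_ball (ell_weak p (dual V))]).

Definition pairing_sum V (z : V^nat) (f : (dual V)^nat) : \bar R :=
  \sum_(j <oo) (rnorm (f j (z j)))%:E.

Definition ell_mid_dual (p : R) V : seq_space V :=
  SeqSpace
    [set z | forall f, ell_mid p (dual V) f -> pairing_sum z f < +oo]
    (fun z => ereal_sup [set pairing_sum z f
                        | f in seq_ball (ell_mid p (dual V))]).

End sequence_spaces.

Section induced_map.
Context {R : realType} {k : base_field} {U V : normedModType (scalars R k)}.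
Variables (S : seq_space U) (S' : seq_space V) (T : {linear U -> V}).

Definition induced_seq (z : U^nat) : V^nat := fun j => T (z j).

Definition induced_well_defined : Prop := forall z, S z -> S' (induced_seq z).

(* Continuity for the metrics given by the norms of [S] and [S']. *)
Definition induced_continuous : Prop :=
  forall z, S z -> forall e : R, 0 < e -> exists2 d : R, 0 < d &
    forall z', S z' -> (seq_norm S (z' - z)%R < d%:E)%E ->
      (seq_norm S' (induced_seq z' - induced_seq z)%R < e%:E)%E.

Definition induced_norm : \bar R :=
  ereal_sup [set seq_norm S' (induced_seq z) | z in seq_ball S].

End induced_map.

Definition mid_summing {R : realType} {k : base_field} (p : R)
    {U V : normedModType (scalars R k)} (T : {linear U -> V}) : Prop :=
  induced_well_defined (ell_mid p U) (ell p%:E V) T /\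
  induced_continuous (ell_mid p U) (ell p%:E V) T.

Definition mid_summing_norm {R : realType} {k : base_field} (p : R)
    {U V : normedModType (scalars R k)} (T : {linear U -> V}) : \bar R :=
  induced_norm (ell_mid p U) (ell p%:E V) T.

(* Main.v *)
(* Each induced map is well defined and continuous if and only if its norm is
   finite (a gliding hump shows that every sequence of [ell_mid] has finite
   norm), so both parts follow from equalities of norms that also hold when
   these are infinite.  Three of the four inequalities are Hoelder's inequality
   together with norming functionals.  The fourth, [adjoint_induced_le], bounds
   sums of [phi_j (T' f_j)] for [T'] the adjoint of [T] and [phi_j] in [X''],
   where the mid norm is a supremum over other functionals than on [X].  It
   amounts to [mid_bidual]: if [|sum_j g_j (x_j)| <= C] on the mid unit ball of
   [X^m], where [g_j] is in [X'], then [|sum_j phi_j (g_j)| <= C] on the mid unit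
   ball of the m-th power of [X''].
   Let [d_i] be finitely many vectors that norm [K^m] up to [1 + e].  By
   Hahn-Banach on bounded functions there is a finitely additive mean that
   represents [g] as an average of the norming combinations
   [sum_n s_n^(1-1/p) d_(i n) f_n].  Averaging separately over each cell
   [i n = i] and applying Hoelder's inequality for the mean gives finitely many
   [h_i] in [X'], weakly p-summable with norm at most 1, such that
   [g_j = C (1 + e) sum_i s_i^(1-1/p) d_(i j) h_i].  This representation can be
   tested on the [phi_j].

   The exponent [1/q] conjugate to [p] is written [1 - 1/p] throughout: since
   [0 `^ 0 = 1], the unit ball of [ell_q] consists of the [z] with
   [|z_j| <= s_j `^ (1 - 1/p)] for some [s_j >= 0] with [sum_j s_j <= 1], for
   [p = 1] as well. *)
Require Import Defs.
From HB Require Import structures.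
From mathcomp Require Import all_boot all_order all_algebra.
From mathcomp Require Import all_classical all_reals all_analysis.
From mathcomp Require Import complex ring lra ess_sup_inf.
Import Order.TTheory GRing.Theory Num.Theory.
Import numFieldNormedType.Exports.

Set Implicit Arguments.
Unset Strict Implicit.
Unset Printing Implicit Defensive.

Local Open Scope classical_set_scope.
Local Open Scope ring_scope.

(** * Hoelder's inequality *)

Section geometric_mean.
Context {R : realType}.
Implicit Types r c d s a x : R.

(** This is Young's inequality for [(c s)^r] and [(d a)^(1-r)]; the balance condition on [c] and [d]
    keeps their product equal to [s^r a^(1-r)]. The bound is linear in [s] and [a], so sums and
    means preserve it. *)
Lemma weighted_young r c d s a : 0 <= r < 1 -> 0 < c -> 0 < d ->
  c `^ r * d `^ (1 - r) = 1 -> 0 <= s -> 0 <= a ->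
  s `^ r * a `^ (1 - r) <= r * c * s + (1 - r) * d * a.
Proof.
move=> /andP[r0 r1] c0 d0 cd s0 a0.
have r'0 : 0 < 1 - r by rewrite subr_gt0.
(* At [r = 0] there is no exponent [1/r]; the balance condition then reads [d = 1]. *)
move: r0; rewrite le_eqVlt => /orP[/eqP r0|r0].
  move: cd; rewrite -r0 !powRr0 subr0 !powRr1 ?(ltW d0)// !mul1r => ->.
  by rewrite !mul0r add0r mul1r.
have -> : s `^ r * a `^ (1 - r) = (c * s) `^ r * (d * a) `^ (1 - r).
  rewrite !powRM ?(ltW c0) ?(ltW d0)//.
  by rewrite mulrACA cd mul1r.
have := @conjugate_powR R ((c * s) `^ r) ((d * a) `^ (1 - r)) r^-1 (1 - r)^-1.
rewrite -!powRrM !divff ?gt_eqF// !powRr1 ?mulr_ge0 ?(ltW c0) ?(ltW d0)// !invrK.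
rewrite !powR_ge0 !invr_gt0 r0 r'0 => /(_ isT isT isT isT).
rewrite addrC subrK => /(_ erefl) H.
by apply: (le_trans H); rewrite le_eqVlt; apply/orP; left; apply/eqP; ring.
Qed.

(** The product is recovered by optimising over the weights [c = t^(1-r)], [d = t^(-r)]. For
    positive [s] and [a] the best [t] is [a / s]; if one of them is 0, a suitable extreme [t] makes
    the remaining term at most any given [e]. *)
Lemma le_geometric_mean r x s a : 0 <= r < 1 -> 0 <= s -> 0 <= a ->
  (forall c d, 0 < c -> 0 < d -> c `^ r * d `^ (1 - r) = 1 ->
     x <= r * c * s + (1 - r) * d * a) ->
  x <= s `^ r * a `^ (1 - r).
Proof.
move=> /andP[r0 r1] s0 a0 H.
have r'0 : 0 < 1 - r by rewrite subr_gt0.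
move: r0; rewrite le_eqVlt => /orP[/eqP r0|r0].
  have := H 1 1 ltr01 ltr01.
  by rewrite -r0 !powRr0 subr0 !powRr1// !mul1r => /(_ erefl); rewrite !mul0r add0r.
have balance t : 0 < t -> (t `^ (1 - r)) `^ r * (t `^ - r) `^ (1 - r) = 1.
  move=> t0; rewrite -!powRrM -powRD ?(gt_eqF t0) ?implybT//.
  by rewrite (_ : _ + _ = 0) ?powRr0//; ring.
move: s0; rewrite le_eqVlt => /orP[/eqP s0|s0].
  rewrite -s0 powR0 ?gt_eqF// mul0r; apply/ler_addgt0Pr => e e0; rewrite add0r.
  (* With this [t] the weight [d = t^(-r)] is [e / (a + 1)]. *)
  pose t := ((a + 1) / e) `^ r^-1.
  have t0 : 0 < t by rewrite powR_gt0// divr_gt0// ltr_wpDl.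
  apply: (le_trans (H _ _ (powR_gt0 _ t0) (powR_gt0 _ t0) (balance _ t0))).
  rewrite -s0 mulr0 add0r powRN /t -powRrM mulVf ?gt_eqF// powRr1; last first.
    by rewrite divr_ge0// ?addr_ge0// ltW.
  rewrite invf_div -mulrA; apply: (@le_trans _ _ (e / (a + 1) * a)).
    apply: ler_piMl; last by rewrite lerBlDr lerDl ltW.
    by rewrite !mulr_ge0 ?invr_ge0 ?addr_ge0// ltW.
  by rewrite -mulrA ger_pMr// mulrC ler_pdivrMr ?mul1r ?lerDl// ltr_wpDl.
move: a0; rewrite le_eqVlt => /orP[/eqP a0|a0].
  rewrite -a0 powR0 ?gt_eqF// mulr0; apply/ler_addgt0Pr => e e0; rewrite add0r.
  (* With this [t] the weight [c = t^(1-r)] is [e / (s + 1)]. *)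
  pose t := (e / (s + 1)) `^ (1 - r)^-1.
  have t0 : 0 < t by rewrite powR_gt0// divr_gt0// ltr_wpDl// ltW.
  apply: (le_trans (H _ _ (powR_gt0 _ t0) (powR_gt0 _ t0) (balance _ t0))).
  rewrite -a0 mulr0 addr0 /t -powRrM mulVf ?gt_eqF// powRr1; last first.
    by rewrite divr_ge0// ?addr_ge0// ltW.
  rewrite -mulrA; apply: (@le_trans _ _ (e / (s + 1) * s)).
    apply: ler_piMl; last exact: ltW.
    by rewrite !mulr_ge0 ?invr_ge0 ?addr_ge0// ltW.
  by rewrite -mulrA ger_pMr// mulrC ler_pdivrMr ?mul1r ?lerDl// ltr_wpDl// ltW.
pose t := a / s.
have t0 : 0 < t by rewrite divr_gt0.
apply: (le_trans (H _ _ (powR_gt0 _ t0) (powR_gt0 _ t0) (balance _ t0))).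
have aE : a = t * s by rewrite mulfVK ?gt_eqF.
rewrite powRN [in leRHS]aE powRM ?(ltW t0) ?(ltW s0)//.
rewrite [leRHS]mulrCA -powRD ?(gt_eqF s0) ?implybT// [r + _]addrC subrK powRr1 ?(ltW s0)//.
rewrite [X in _ + (_ * _) * X]aE.
have -> : (1 - r) * (t `^ r)^-1 * (t * s) = (1 - r) * (t `^ (1 - r) * s).
  by rewrite powRB ?(gt_eqF t0) ?implybT// powRr1 ?(ltW t0)//; ring.
by rewrite le_eqVlt; apply/orP; left; apply/eqP; ring.
Qed.

(** Young's inequality is summed with fixed weights and the weights are optimised afterwards.
    [mid_representation] repeats this argument with a mean in place of the sum. *)
Lemma sum_geometric_mean (I : Type) (l : seq I) (P : pred I) r (s a : I -> R) :
  0 <= r < 1 -> (forall i, P i -> 0 <= s i) -> (forall i, P i -> 0 <= a i) ->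
  \sum_(i <- l | P i) s i `^ r * a i `^ (1 - r) <=
  (\sum_(i <- l | P i) s i) `^ r * (\sum_(i <- l | P i) a i) `^ (1 - r).
Proof.
move=> r01 s0 a0; apply: le_geometric_mean => //; rewrite ?sumr_ge0// => c d c0 d0 cd.
rewrite !mulr_sumr -big_split/=; apply: ler_sum => i Pi.
exact: weighted_young (s0 _ Pi) (a0 _ Pi).
Qed.

Variables (p : R) (p1 : 1 <= p).
Let p0 : 0 < p. Proof. exact: lt_le_trans p1. Qed.

Lemma conj_exp_itv : 0 <= 1 - p^-1 < 1.
Proof. by rewrite subr_ge0 invf_le1// p1 ltrBlDr ltrDl invr_gt0. Qed.

Lemma powR_conj_exp x : 0 <= x -> (x `^ p) `^ (1 - (1 - p^-1)) = x.
Proof. by move=> x0; rewrite opprB addrC subrK -powRrM mulfV ?gt_eqF// powRr1. Qed.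

Lemma sum_hoelder (I : Type) (l : seq I) (P : pred I) (s a : I -> R) :
  (forall i, P i -> 0 <= s i) -> (forall i, P i -> 0 <= a i) ->
  \sum_(i <- l | P i) s i `^ (1 - p^-1) * a i <=
  (\sum_(i <- l | P i) s i) `^ (1 - p^-1) * (\sum_(i <- l | P i) a i `^ p) `^ p^-1.
Proof.
move=> s0 a0; have := @sum_geometric_mean I l P (1 - p^-1) s (fun i => a i `^ p).
move=> /(_ conj_exp_itv s0 (fun i _ => powR_ge0 _ _)).
rewrite (_ : 1 - (1 - p^-1) = p^-1); last by ring.
apply: le_trans; apply: ler_sum => i Pi.
by rewrite -powRrM mulfV ?gt_eqF// powRr1// a0.
Qed.

Lemma sum_hoelder1 (I : Type) (l : seq I) (P : pred I) (s a : I -> R) :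
  (forall i, P i -> 0 <= s i) -> (forall i, P i -> 0 <= a i) ->
  \sum_(i <- l | P i) s i <= 1 ->
  \sum_(i <- l | P i) s i `^ (1 - p^-1) * a i <=
  (\sum_(i <- l | P i) a i `^ p) `^ p^-1.
Proof.
move=> s0 a0 s1; apply: le_trans (sum_hoelder l s0 a0) _.
rewrite ler_piMl ?powR_ge0// -[leRHS](powRr0 (\sum_(i <- l | P i) s i)).
have /andP[r0 _] := conj_exp_itv; rewrite powRr0.
rewrite -[leRHS](_ : 1 `^ (1 - p^-1) = 1); last by rewrite powR1.
by apply: ge0_ler_powR; rewrite ?nnegrE ?sumr_ge0.
Qed.

Lemma hoelder_extremal (I : Type) (l : seq I) (b : I -> R) : (forall i, 0 <= b i) ->
  exists2 s : I -> R, (forall i, 0 <= s i) /\ \sum_(i <- l) s i <= 1 &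
    \sum_(i <- l) s i `^ (1 - p^-1) * b i = (\sum_(i <- l) b i `^ p) `^ p^-1.
Proof.
move=> b0; set t := \sum_(i <- l) b i `^ p.
have t0 : 0 <= t by rewrite sumr_ge0// => i _; rewrite powR_ge0.
have rp : p * (1 - p^-1) + 1 = p by rewrite mulrBr mulfV ?gt_eqF// mulr1 subrK.
(* The equality case of Hoelder's inequality. If [t = 0], division by 0 gives the zero weights and
   both sides vanish. *)
exists (fun i => b i `^ p / t).
  split=> [i|]; first by rewrite divr_ge0// powR_ge0.
  rewrite -mulr_suml -/t; have [->|tn0] := eqVneq t 0; first by rewrite mul0r.
  by rewrite divff.
have eqt i : (b i `^ p / t) `^ (1 - p^-1) * b i = b i `^ p * t^-1 `^ (1 - p^-1).
  rewrite powRM ?powR_ge0 ?invr_ge0// mulrAC; congr (_ * _).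
  rewrite -powRrM -[X in _ * X = _]powRr1// -[in RHS]rp powRD//.
  by rewrite rp gt_eqF.
under eq_bigr do rewrite eqt.
rewrite -mulr_suml -/t; move: t0; rewrite le_eqVlt => /orP[/eqP <-|t0].
  by rewrite mul0r powR0// invr_neq0// gt_eqF.
rewrite -powR_inv1 ?(ltW t0)// -powRrM -[X in X * _]powRr1 ?(ltW t0)// -powRD.
  by congr (_ `^ _); ring.
by rewrite (gt_eqF t0) implybT.
Qed.

End geometric_mean.

(** * Hahn-Banach *)

Section hahn_banach.
Context {R : realType} {V : lmodType R}.

(** One inequality for positive scalars is enough: [sublinearZ] obtains equality by applying it to
    the inverse scalar. *)
Definition sublinear (q : V -> R) :=
  (forall u v, q (u + v) <= q u + q v) /\
  (forall a v, 0 < a -> q (a *: v) <= a * q v).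

Lemma sublinearZ q a v : sublinear q -> 0 < a -> q (a *: v) = a * q v.
Proof.
move=> [_ qZ] a0; apply/eqP; rewrite eq_le qZ//=.
have := qZ a^-1 (a *: v); rewrite invr_gt0 => /(_ a0).
by rewrite scalerA mulVf ?gt_eqF// scale1r mulrC ler_pdivlMr// mulrC.
Qed.

Lemma sublinear0 q : sublinear q -> q 0 = 0.
Proof.
move=> qs; have := sublinearZ 0 qs (ltr0n R 2); rewrite scaler0.
by move=> /eqP; rewrite -subr_eq0 -{1}[q 0]mul1r -mulrBl mulf_eq0 => /orP[|/eqP//]; lra.
Qed.

Lemma sublinear_geN q v : sublinear q -> - q (- v) <= q v.
Proof.
move=> qs; have := qs.1 v (- v).
by rewrite subrr sublinear0// -lerBlDr sub0r.
Qed.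

(** The function [q' v = inf (q (v + t y) - t q y)] over [t >= 0] is sublinear and below [q].
    Minimality gives [q x <= q' x], and [t = 1] gives [q' x <= q (x + y) - q y]. *)
Lemma minimal_sublinear_additive q : sublinear q ->
  (forall q', sublinear q' -> (forall v, q' v <= q v) -> forall v, q v <= q' v) ->
  forall u v, q (u + v) = q u + q v.
Proof.
move=> qs qmin x y; apply/eqP; rewrite eq_le qs.1/=.
pose A v := [set q (v + t *: y) - t * q y | t in [set t | 0 <= t]].
have lbA v : lbound (A v) (- q (- v)).
  move=> _ [t /= t0 <-].
  suff : t * q y <= q (t *: y).
    by have := qs.1 (v + t *: y) (- v); rewrite addrAC addrN add0r; lra.
  move: t0; rewrite le_eqVlt => /orP[/eqP <-|t0].
    by rewrite scale0r mul0r sublinear0.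
  by rewrite (sublinearZ _ qs).
have iA v : has_inf (A v).
  split; last by exists (- q (- v)); exact: lbA.
  by exists (q (v + 0 *: y) - 0 * q y), 0 => /=.
pose q' v := inf (A v).
have q'le v t : 0 <= t -> q' v <= q (v + t *: y) - t * q y.
  by move=> t0; apply: ge_inf; [exact: (iA v).2|exists t].
have q's : sublinear q'.
  split=> [u v|a v a0].
    rewrite -lerBlDr; apply: lb_le_inf; first exact: (iA u).1.
    move=> _ [t /= t0 <-]; rewrite lerBlDr -lerBlDl.
    apply: lb_le_inf; first exact: (iA v).1.
    move=> _ [t' /= t'0 <-]; rewrite lerBlDl.
    apply: le_trans (q'le _ (t + t') (addr_ge0 t0 t'0)) _.
    rewrite scalerDl mulrDl addrACA.
    by have := qs.1 (u + t *: y) (v + t' *: y); lra.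
  rewrite mulrC -ler_pdivrMr//; apply: lb_le_inf; first exact: (iA v).1.
  move=> _ [t /= t0 <-]; rewrite ler_pdivrMr//.
  apply: le_trans (q'le _ (a * t) (mulr_ge0 (ltW a0) t0)) _.
  by rewrite -scalerA -scalerDr sublinearZ// mulrBl -mulrA [q _ * a]mulrC; lra.
have q'q v : q' v <= q v.
  by apply: le_trans (q'le v 0 (lexx _)) _; rewrite scale0r addr0 mul0r subr0.
have := le_trans (qmin q' q's q'q x) (q'le x 1 ler01).
by rewrite scale1r mul1r lerBrDr.
Qed.

(** Lower bounds of chains, for Zorn's lemma. The infimum is finite because [- Q (- v)] bounds every
    [q v] below; for subadditivity, two members of the chain are replaced by the smaller one. *)
Lemma sublinear_inf (A : set (V -> R)) (Q : V -> R) : A !=set0 ->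
  (forall q, A q -> sublinear q /\ forall v, q v <= Q v) ->
  total_on A (fun q q' => forall v, q' v <= q v) ->
  let m v := inf [set q v | q in A] in
  sublinear m /\ forall q, A q -> forall v, m v <= q v.
Proof.
move=> [q0 Aq0] AQ Atot m.
have iA v : has_inf [set q v | q in A].
  split; first by exists (q0 v), q0.
  exists (- Q (- v)) => _ [q /AQ[qs qQ] <-].
  by apply: le_trans (sublinear_geN _ qs); rewrite lerN2.
have mle q v : A q -> m v <= q v.
  by move=> Aq; apply: ge_inf; [exact: (iA v).2|exists q].
split; last by move=> q Aq v; exact: mle.
split=> [u v|a v a0].
  rewrite -lerBlDr; apply: lb_le_inf; first exact: (iA u).1.
  move=> _ [q Aq <-]; rewrite lerBlDr -lerBlDl.
  apply: lb_le_inf; first exact: (iA v).1.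
  move=> _ [q' Aq' <-]; rewrite lerBlDl.
  have [|] := Atot q q' Aq Aq' => qq'.
    apply: le_trans (mle q' _ Aq') _.
    apply: le_trans ((AQ _ Aq').1.1 u v) _; exact: lerD.
  apply: le_trans (mle q _ Aq) _.
  apply: le_trans ((AQ _ Aq).1.1 u v) _; exact: lerD.
rewrite mulrC -ler_pdivrMr//; apply: lb_le_inf; first exact: (iA v).1.
move=> _ [q Aq <-]; rewrite ler_pdivrMr//.
by apply: le_trans (mle q _ Aq) _; rewrite mulrC; exact: (AQ _ Aq).1.2.
Qed.

Theorem hahn_banach (Q : V -> R) : sublinear Q ->
  exists2 L : V -> R, linear (L : V -> R^o) & forall v, L v <= Q v.
Proof.
move=> Qs.
pose T := {q : V -> R | sublinear q /\ forall v, q v <= Q v}.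
(* The order is reversed, so that a maximal element is a minimal sublinear function below [Q]. *)
pose le (q q' : T) : bool := `[< forall v, sval q' v <= sval q v >].
have QT : sublinear Q /\ forall v, Q v <= Q v by split.
have [|||q qmax] := @ZL_preorder T (exist _ Q QT) le.
- by move=> q; apply/asboolP.
- move=> q r s /asboolP qr /asboolP rs; apply/asboolP => v.
  exact: le_trans (rs v) (qr v).
- move=> A Atot; have [->|/set0P[q0 Aq0]] := eqVneq A set0.
    by exists (exist _ Q QT).
  have [||| ms mle] := @sublinear_inf [set sval q | q in A] Q.
  + by exists (sval q0), q0.
  + by move=> _ [q _ <-]; exact: (svalP q).
  + move=> _ _ [q Aq <-] [q' Aq' <-].
    by have [/asboolP|/asboolP] := Atot q q' Aq Aq'; [left|right].
  set m := (fun v => inf _) in ms mle.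
  have mQ : sublinear m /\ forall v, m v <= Q v.
    split=> // v; apply: le_trans (mle (sval q0) _ v) _; first by exists q0.
    exact: (svalP q0).2.
  by exists (exist _ m mQ) => s As; apply/asboolP => v /=; apply: mle; exists s.
have [qs qQ] := svalP q.
have qmin q' : sublinear q' -> (forall v, q' v <= sval q v) ->
    forall v, sval q v <= q' v.
  move=> q's q'q.
  have q'T : sublinear q' /\ forall v, q' v <= Q v.
    by split=> // v; exact: le_trans (q'q v) (qQ v).
  by have /asboolP := qmax (exist _ q' q'T) (asboolT q'q).
have qD := minimal_sublinear_additive qs qmin.
have qN v : sval q (- v) = - sval q v.
  by apply/eqP; rewrite -addr_eq0 -qD addNr sublinear0.
exists (sval q) => // a u v; rewrite qD; congr (_ + _).
have [a0|a0|->] := ltgtP a 0; last by rewrite !scale0r sublinear0.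
  by rewrite -[a]opprK !(scaleNr (- a)) qN (sublinearZ _ qs) ?oppr_gt0.
by rewrite (sublinearZ _ qs).
Qed.

(* Applying [hahn_banach] to the sublinear function
   [v |-> inf (P (v + w) - r)], [(w, r)] ranging over [G], saves any discussion
   of the subspace spanned by [G]. *)
Theorem hahn_banach_sandwich (P : V -> R) (G : set (V * R)) : sublinear P ->
  G (0, 0) -> (forall x y, G x -> G y -> G (x.1 + y.1, x.2 + y.2)) ->
  (forall a x, 0 < a -> G x -> G (a *: x.1, a * x.2)) ->
  (forall x, G x -> x.2 <= P x.1) ->
  exists L : V -> R, [/\ linear (L : V -> R^o), forall v, L v <= P v &
    forall x, G x -> x.2 <= L x.1].
Proof.
move=> Ps G0 GD GZ GP.
pose A v := [set P (v + x.1) - x.2 | x in G].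
have iA v : has_inf (A v).
  split; first by exists (P (v + 0) - 0), (0, 0).
  exists (- P (- v)) => _ [x Gx <-].
  have := Ps.1 (v + x.1) (- v); rewrite addrAC addrN add0r.
  by have := GP _ Gx; lra.
pose Q v := inf (A v).
have Qle v x : G x -> Q v <= P (v + x.1) - x.2.
  by move=> Gx; apply: ge_inf; [exact: (iA v).2|exists x].
have Qs : sublinear Q.
  split=> [u v|a v a0].
    rewrite -lerBlDr; apply: lb_le_inf; first exact: (iA u).1.
    move=> _ [x Gx <-]; rewrite lerBlDr -lerBlDl.
    apply: lb_le_inf; first exact: (iA v).1.
    move=> _ [y Gy <-]; rewrite lerBlDl.
    apply: le_trans (Qle _ _ (GD _ _ Gx Gy)) _.
    by rewrite /= addrACA; have := Ps.1 (u + x.1) (v + y.1); lra.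
  rewrite mulrC -ler_pdivrMr//; apply: lb_le_inf; first exact: (iA v).1.
  move=> _ [x Gx <-]; rewrite ler_pdivrMr//.
  apply: le_trans (Qle _ _ (GZ _ _ a0 Gx)) _.
  by rewrite /= -scalerDr sublinearZ// mulrBl; lra.
have [L Ll LQ] := hahn_banach Qs; exists L; split=> //.
  move=> v; apply: le_trans (LQ v) _; apply: le_trans (Qle v _ G0) _.
  by rewrite /= addr0 subr0.
move=> x Gx; have := le_trans (LQ (- x.1)) (Qle _ _ Gx).
rewrite addNr sublinear0// sub0r => h.
have LN : L (- x.1) = - L x.1.
  by have := Ll (-1) x.1 0; rewrite addr0 scaleN1r => ->;
     have := Ll (-1) 0 0; rewrite scaleN1r oppr0 addr0 => L0;
     rewrite (_ : L 0 = 0) ?addr0 ?scaleN1r// L0 scaleN1r addNr.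
by rewrite LN in h; lra.
Qed.

End hahn_banach.

(** * Scalars and functionals *)

Section scalar_field.
Context {R : realType} {k : base_field}.
Notation K := (scalars R k).
Notation re := (@scalars_re R k).
Implicit Types (z w : K) (r : R).

Lemma scalars_reD z w : re (z + w) = re z + re w.
Proof. by case: k z w => //= -[? ?] [? ?]. Qed.

Lemma scalars_re0 : re 0 = 0.
Proof. by case: k. Qed.

Lemma scalars_re_sum (I : Type) (l : seq I) (P : pred I) (F : I -> K) :
  re (\sum_(i <- l | P i) F i) = \sum_(i <- l | P i) re (F i).
Proof. exact: (big_morph _ scalars_reD scalars_re0). Qed.

Lemma scalars_reZ r z : re (to_scalars r * z) = r * re z.
Proof. by case: k z => //= -[a b] /=; rewrite mul0r subr0. Qed.

Lemma rnorm_to_scalars r : rnorm (to_scalars r : K^o) = `|r|.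
Proof.
have pos (t : R) : 0 <= t -> rnorm (to_scalars t : K^o) = t.
  by move=> t0; rewrite /rnorm ger0_norm ?to_scalarsK// -(@to_scalars0 R k) ler_to_scalars.
have [r0|r0] := leP 0 r; first by rewrite pos// ger0_norm.
have N : to_scalars (- r) = - to_scalars r :> K.
  by apply/eqP; rewrite -addr_eq0 -to_scalarsD addNr to_scalars0.
by rewrite ltr0_norm// -[RHS]pos ?oppr_ge0 ?ltW// N /rnorm normrN.
Qed.

Lemma rnorm1 : rnorm (1 : K^o) = 1.
Proof. by rewrite -(@to_scalars1 R k) rnorm_to_scalars normr1. Qed.

Lemma rnormM (a b : K^o) : rnorm (a * b : K^o) = rnorm a * rnorm b.
Proof. exact: (@rnormZ R k K^o). Qed.

Lemma rnorm_sum (V : normedModType K) (I : Type) (l : seq I) (P : pred I) (F : I -> V) :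
  rnorm (\sum_(i <- l | P i) F i) <= \sum_(i <- l | P i) rnorm (F i).
Proof.
elim/big_ind2 : _ => //; first by rewrite rnorm0.
by move=> x1 x2 y1 y2 h1 h2; apply: le_trans (rnormD _ _) (lerD h1 h2).
Qed.

Lemma scalars_re_le z : `|re z| <= rnorm (z : K^o).
Proof.
case: k z => [z|[a b]] /=; first by rewrite /rnorm.
apply: (@le_trans _ _ (Num.sqrt (a ^+ 2 + b ^+ 2))).
  by rewrite -sqrtr_sqr ler_sqrt ?addr_ge0 ?sqr_ge0// lerDl sqr_ge0.
by have := lexx (complex.Re `|(a +i* b)%C : R[i]|); rewrite {1}normc_def.
Qed.

Lemma scalars_re_le_rnorm z : re z <= rnorm (z : K^o).
Proof. exact: le_trans (ler_norm _) (scalars_re_le z). Qed.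

Lemma phase z : exists2 u : K, rnorm (u : K^o) = 1 & u * z = to_scalars (rnorm (z : K^o)).
Proof.
have [->|z0] := eqVneq z 0.
  by exists 1; rewrite ?rnorm1// mulr0 (@rnorm0 _ _ K^o) to_scalars0.
have nz0 : rnorm (z : K^o) != 0 by apply: contra z0 => /eqP/rnorm0_eq0 ->.
exists (to_scalars (rnorm (z : K^o)) * z^-1); last by rewrite mulfVK.
apply: (mulIf nz0); rewrite -rnormM -mulrA mulVf// mulr1 mul1r.
by rewrite rnorm_to_scalars ger0_norm// rnorm_ge0.
Qed.

Lemma dual_pred_bounded (V : normedModType K) (f : V -> K^o) (c : R) :
  linear f -> (forall v, rnorm (f v) <= c * rnorm v) -> f \in dual_pred V.
Proof.
move=> lf fc; apply/dual_predP; split=> //.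
pose F := GRing.isLinear.Build K V K^o _ f lf.
pose g : {linear V -> K^o} := HB.pack f F.
suff : continuous g by [].
apply: bounded_linear_continuous; apply/linear_boundedP.
near=> r => v.
rewrite -!rnormK; apply: (@le_trans _ _ (to_scalars (`|c| + 1) * to_scalars (rnorm v))).
  rewrite -to_scalarsM ler_to_scalars; apply: (le_trans (fc v)).
  by rewrite ler_wpM2r ?rnorm_ge0// (le_trans (ler_norm c))// lerDl.
rewrite ler_wpM2r ?rnormK//.
near: r; apply: nbhs_pinfty_ge.
rewrite realE; apply/orP; left.
by rewrite -(@to_scalars0 R k) ler_to_scalars addr_ge0.
Unshelve. all: by end_near. Qed.

(* The functional with real part [rho] is [v |-> rho v - i * rho (i * v)]. *)
Lemma dual_of_re (V : normedModType K) (rho : V -> R) (c : R) :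
  (forall u v, rho (u + v) = rho u + rho v) ->
  (forall r v, rho (to_scalars r *: v) = r * rho v) ->
  (forall v, rho v <= c * rnorm v) ->
  exists2 f : dual V, forall v, re (f v) = rho v & forall v, rnorm (f v) <= c * rnorm v.
Proof.
move=> rhoD rhoZ rhoc.
suff [f lf fre] : exists2 f : V -> K^o, linear f & forall v, re (f v) = rho v.
  have fc v : rnorm (f v) <= c * rnorm v.
    have [u u1 uf] := phase (f v).
    have f0 : f 0 = 0.
      by have := lf (-1) 0 0; rewrite scaleN1r oppr0 addr0 scaleN1r addNr.
    rewrite -[leLHS](@to_scalarsK R k) -uf.
    have -> : u * f v = f (u *: v) by have := lf u v 0; rewrite f0 !addr0.
    by rewrite fre (le_trans (rhoc _))// rnormZ u1 mul1r.
  by exists (Dual (dual_pred_bounded lf fc)).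
case: k V rho rhoD rhoZ {rhoc} => [V rho rhoD rhoZ|V rho rhoD rhoZ].
  by exists rho => // a u v; rewrite rhoD; congr (_ + _); exact: rhoZ.
exists (fun v => (rho v -i* rho ('i%C *: v))%C : (scalars R ComplexField)^o) => //.
move=> [x y] u v.
have iE (a b : R) (w : V) : rho ((a +i* b)%C *: w) = a * rho w + b * rho ('i%C *: w).
  rewrite -!rhoZ -rhoD; congr rho; rewrite scalerA -scalerDl; congr (_ *: _).
  by apply/eqP; rewrite eq_complex /=; apply/andP; split; apply/eqP; ring.
have iM : 'i%C * (x +i* y)%C = (- y +i* x)%C :> R[i].
  by apply/eqP; rewrite eq_complex /=; apply/andP; split; apply/eqP; ring.
rewrite scalerDr scalerA iM !rhoD (iE x y) (iE (- y) x).
by apply/eqP; rewrite eq_complex /=; apply/andP; split; apply/eqP; ring.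
Qed.

End scalar_field.

(** A copy of [V] that carries the real module structure obtained by restriction of scalars, so that
    the real Hahn-Banach theorem applies to it. *)
Definition realified {R : realType} {k : base_field}
  (V : normedModType (scalars R k)) : Type := V.

Section realified.
Context {R : realType} {k : base_field} (V : normedModType (scalars R k)).
Notation W := (realified V).

HB.instance Definition _ := GRing.Zmodule.on W.

Let scale (r : R) (v : W) : W := (to_scalars r : scalars R k) *: (v : V).

Let scaleA a b v : scale a (scale b v) = scale (a * b) v.
Proof. by rewrite /scale scalerA -to_scalarsM. Qed.

Let scale1 : left_id 1 scale.
Proof. by move=> v; rewrite /scale to_scalars1 scale1r. Qed.

Let scaleDr : right_distributive scale +%R.
Proof. by move=> a u v; rewrite /scale scalerDr. Qed.

Let scaleDl v : {morph scale^~ v : a b / a + b}.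
Proof. by move=> a b; rewrite /scale to_scalarsD scalerDl. Qed.

HB.instance Definition _ :=
  GRing.Zmodule_isLmodule.Build R W scaleA scale1 scaleDr scaleDl.

Lemma realified_scaleE (r : R) (v : V) :
  r *: (v : W) = (to_scalars r : scalars R k) *: v.
Proof. by []. Qed.

(** A real linear form is sandwiched below the norm and above its values on the half-line through
    [v]; [dual_of_re] turns it into a [K]-linear functional. *)
Lemma norming_functional (v : V) : exists2 f : dual V,
  forall u, rnorm (f u) <= rnorm u & scalars_re (f v) = rnorm v.
Proof.
pose P (u : W) := rnorm (u : V).
pose G : set (W * R) := [set x | exists2 a, 0 <= a & x = (a *: (v : W), a * rnorm v)].
have PZ (a : R) (u : W) : 0 <= a -> P (a *: u) = a * P u.
  by move=> a0; rewrite /P realified_scaleE rnormZ rnorm_to_scalars ger0_norm.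
have Ps : sublinear P.
  by split=> [u w|a u a0]; [exact: rnormD|rewrite PZ// ltW].
have [||||L [Ll LP LG]] := @hahn_banach_sandwich R W P G Ps.
- by exists 0 => //; rewrite scale0r mul0r.
- move=> _ _ [a a0 ->] [b b0 ->]; exists (a + b); first exact: addr_ge0.
  by rewrite /= scalerDl mulrDl.
- move=> b _ b0 [a a0 ->]; exists (b * a); first by rewrite mulr_ge0// ltW.
  by rewrite /= scalerA mulrA.
- by move=> _ [a a0 ->] /=; rewrite PZ.
have L0 : L 0 = 0.
  by have := Ll (-1) 0 0; rewrite scaler0 addr0 scaleN1r addNr.
have [||| f fre fle] := @dual_of_re R k V L 1.
- by move=> u w; have := Ll 1 u w; rewrite !scale1r.
- by move=> r u; have := Ll r u 0; rewrite addr0 realified_scaleE L0 addr0.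
- by move=> u; rewrite mul1r; exact: LP.
exists f => [u|]; first by rewrite -[leRHS]mul1r.
rewrite fre; apply/eqP; rewrite eq_le [L v <= _]LP/=.
have := LG (v, rnorm v); apply; exists 1; rewrite ?ler01//.
by rewrite scale1r mul1r.
Qed.

End realified.

(** * Finitely additive means on bounded functions *)

Section mean.
Context {R : realType} (I : Type).

Definition bounded_function : {pred I -> R^o} :=
  mem [set u : I -> R^o | exists c, forall i, `|u i| <= c].

Lemma bounded_functionP (u : I -> R^o) :
  reflect (exists c, forall i, `|u i| <= c) (u \in bounded_function).
Proof. by apply: (iffP idP) => [/set_mem|/mem_set]. Qed.

Lemma bounded_submod_closed : submod_closed bounded_function.
Proof.
split; first by apply/bounded_functionP; exists 0 => i; rewrite normr0.
move=> a u v /bounded_functionP[c uc] /bounded_functionP[c' vc'].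
apply/bounded_functionP; exists (`|a| * c + c') => i.
apply: le_trans (ler_normD _ _) _; apply: lerD => //.
by rewrite normrM ler_wpM2l.
Qed.

HB.instance Definition _ :=
  GRing.isSubmodClosed.Build _ _ bounded_function bounded_submod_closed.

Record bounded_fun := BoundedFun
  { bounded_fun_val :> I -> R^o ; _ : bounded_fun_val \in bounded_function }.
HB.instance Definition _ := [isSub for bounded_fun_val].
HB.instance Definition _ := [Choice of bounded_fun by <:].
HB.instance Definition _ := [SubChoice_isSubLmodule of bounded_fun by <:].

(** The sandwich theorem for the supremum as sublinear function. The last hypothesis on [G] says
    that the prescribed lower bounds lie below the supremum; [i0] makes the ranges nonempty. *)
Lemma exists_mean (i0 : I) (G : set ((I -> R^o) * R)) : G (0, 0) ->
  (forall x y, G x -> G y -> G (x.1 + y.1, x.2 + y.2)) ->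
  (forall a x, 0 < a -> G x -> G (a *: x.1, a * x.2)) ->
  (forall x, G x -> x.1 \in bounded_function) ->
  (forall x c, G x -> (forall i, x.1 i <= c) -> x.2 <= c) ->
  exists m : (I -> R^o) -> R, [/\
    {in bounded_function &, forall u v, m (u + v) = m u + m v},
    forall a, {in bounded_function, forall u, m (a *: u) = a * m u},
    forall c, {in bounded_function, forall u, (forall i, u i <= c) -> m u <= c} &
    forall x, G x -> x.2 <= m x.1].
Proof.
move=> G0 GD GZ Gb Gc.
pose P (u : bounded_fun) : R := sup (range (u : I -> R)).
have hasP (u : bounded_fun) : has_sup (range (u : I -> R)).
  split; first by exists (u i0), i0.
  have /bounded_functionP[c uc] := valP u.
  by exists c => _ [i _ <-]; exact: le_trans (ler_norm _) (uc i).
have Pub (u : bounded_fun) i : u i <= P u.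
  by apply: ub_le_sup; [exact: (hasP u).2|exists i].
have Ple (u : bounded_fun) c : (forall i, u i <= c) -> P u <= c.
  by move=> uc; apply: ge_sup; [exact: (hasP u).1|move=> _ [i _ <-]].
have Ps : sublinear P.
  split=> [u v|a u a0]; apply: Ple => i.
    by rewrite /=; apply: lerD; exact: Pub.
  by rewrite /= ler_pM2l.
pose G' : set (bounded_fun * R) := [set x | G (val x.1, x.2)].
have [||||L [Ll LP LG]] := @hahn_banach_sandwich R _ P G' Ps.
- exact: G0.
- by move=> x y Gx Gy; exact: GD Gx Gy.
- by move=> a x a0 Gx; exact: GZ a0 Gx.
- by move=> x Gx; apply: (Gc _ _ Gx) => i; exact: Pub.
have L0 : L 0 = 0.
  by have := Ll (-1) 0 0; rewrite scaler0 addr0 scaleN1r addNr.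
(* Outside the bounded functions [m] takes the default value 0; its properties are claimed for
   bounded functions. *)
pose m (u : I -> R^o) : R := if insub u is Some u' then L u' else 0.
have mE (u : bounded_fun) : m (val u) = L u by rewrite /m valK.
have mE' (u : I -> R^o) (ub : u \in bounded_function) : m u = L (BoundedFun ub).
  exact: (mE (BoundedFun ub)).
exists m; split.
- move=> u v ub vb.
  transitivity (m (val (BoundedFun ub + BoundedFun vb))); first by [].
  by rewrite mE !mE' -[BoundedFun ub]scale1r Ll !scale1r.
- move=> a u ub; transitivity (m (val (a *: BoundedFun ub))); first by [].
  by rewrite mE mE' -[a *: _]addr0 Ll L0 addr0.
- by move=> c u ub uc; rewrite mE'; apply: le_trans (LP _) _; apply: Ple => i; exact: uc.
- move=> x Gx; rewrite (mE' _ (Gb _ Gx)).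
  by apply: (LG (BoundedFun (Gb _ Gx), x.2)); rewrite /G'/=; case: x Gx.
Qed.

End mean.

(** * Finite norming sets *)

Section norming_set.
Context {R : realType} {k : base_field}.
Notation K := (scalars R k).
Notation re := (@scalars_re R k).

Definition scalars_im : K -> R :=
  match k return scalars R k -> R with
  | RealField => fun=> 0 | ComplexField => fun z => complex.Im z end.

Lemma rnorm_le_re_im (z : K) : rnorm (z : K^o) <= `|re z| + `|scalars_im z|.
Proof.
rewrite /scalars_im; case: k z => [z|[a b]] /=; first by rewrite normr0 addr0 /rnorm.
apply: (@le_trans _ _ (Num.sqrt (a ^+ 2 + b ^+ 2))).
  by have := lexx (complex.Re `|(a +i* b)%C : R[i]|); rewrite {2}normc_def.
rewrite -[leRHS]ger0_norm ?addr_ge0// -sqrtr_sqr ler_sqrt ?sqr_ge0//.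
rewrite sqrrD !real_normK ?num_real// -addrA lerD2l [_ + b ^+ 2]addrC lerDl.
by rewrite mulrn_wge0// mulr_ge0.
Qed.

Lemma scalars_im_le (z : K) : `|scalars_im z| <= rnorm (z : K^o).
Proof.
rewrite /scalars_im; case: k z => [z|[a b]] /=; first by rewrite normr0 /rnorm /=.
apply: (@le_trans _ _ (Num.sqrt (a ^+ 2 + b ^+ 2))).
  by rewrite -sqrtr_sqr ler_sqrt ?addr_ge0 ?sqr_ge0// lerDr sqr_ge0.
by have := lexx (complex.Re `|(a +i* b)%C : R[i]|); rewrite {1}normc_def.
Qed.

Lemma scalars_imB (z w : K) : scalars_im (z - w) = scalars_im z - scalars_im w.
Proof. by rewrite /scalars_im; case: k z w => [? ?|[? ?] [? ?]] //=; rewrite subr0. Qed.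

Lemma scalars_reB (z w : K) : re (z - w) = re z - re w.
Proof. by case: k z w => [? ?|[? ?] [? ?]]. Qed.

(** The interval [[-1, 1]] is cut into [2 L] pieces of length [1 / L], and its right end 1 falls
    into one more cell. *)
Lemma unit_interval_cells (L : nat) : (0 < L)%N -> exists cell : R -> 'I_(2 * L).+1,
  forall s t, `|s| <= 1 -> `|t| <= 1 -> cell s = cell t -> `|s - t| <= L%:R^-1.
Proof.
move=> L0; pose c (t : R) := Num.truncn ((t + 1) * L%:R).
have L0' : 0 < L%:R :> R by rewrite ltr0n.
have cP t : `|t| <= 1 -> (c t < (2 * L).+1)%N /\
    (c t)%:R <= (t + 1) * L%:R < (c t).+1%:R.
  rewrite ler_norml => /andP[t1 t2].
  have h0 : 0 <= (t + 1) * L%:R by rewrite mulr_ge0 ?(ltW L0')//; lra.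
  have h := truncn_itv h0; split=> //; move/andP: h => [h _].
  rewrite ltnS -(ler_nat R) (le_trans h)// natrM ler_pM2r//; lra.
exists (fun t => inord (c t)) => s t s1 t1 /(congr1 val).
have [sL /andP[s2 s3]] := cP s s1; have [tL /andP[t2 t3]] := cP t t1.
rewrite /= !inordK// => st; rewrite -st -natr1 in s3 t2 t3.
rewrite -[leRHS]mul1r ler_pdivlMr// -[X in _ * X]gtr0_norm// -normrM.
by rewrite ler_norml; apply/andP; split; rewrite mulrBl; lra.
Qed.

Lemma unit_ball_cells (e : R) : 0 < e -> exists (F : finType) (cell : K -> F),
  forall z w, rnorm (z : K^o) <= 1 -> rnorm (w : K^o) <= 1 -> cell z = cell w ->
  rnorm (z - w : K^o) <= e.
Proof.
(* Then [1 / L < e / 2], which leaves half of [e] to each of the real and imaginary parts. *)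
move=> e0; pose L := (Num.truncn (2 / e)).+1.
have [//|cell cellP] := @unit_interval_cells L.
exists ('I_(2 * L).+1 * 'I_(2 * L).+1)%type.
exists (fun z => (cell (re z), cell (scalars_im z))) => z w z1 w1 [cre cim].
apply: le_trans (rnorm_le_re_im _) _.
apply: (@le_trans _ _ (L%:R^-1 + L%:R^-1)).
  rewrite scalars_reB scalars_imB.
  by apply: lerD; apply: cellP => //; (apply: le_trans (scalars_re_le _) _ => //) ||
    (apply: le_trans (scalars_im_le _) _ => //).
have L2 : 2 / e < L%:R by apply: truncnS_gt.
rewrite -mulr2n -[_ *+ 2]mulr_natl ler_pdivrMr ?ltr0n// mulrC -ler_pdivrMr//.
exact: ltW.
Qed.

Variables (p : R) (p1 : 1 <= p).
Let p0 : 0 < p. Proof. exact: lt_le_trans p1. Qed.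

Definition lp_norm m (b : nat -> K) : R :=
  (\sum_(j < m) rnorm (b j : K^o) `^ p) `^ p^-1.

Lemma lp_norm_ge m (b : nat -> K) (j : 'I_m) : rnorm (b j : K^o) <= lp_norm m b.
Proof.
have pn0 : p != 0 by rewrite gt_eqF.
rewrite /lp_norm (bigD1 j)//= -[leLHS]powRr1 ?rnorm_ge0// -(mulfV pn0) powRrM.
apply: ge0_ler_powR; rewrite ?nnegrE ?invr_ge0 ?(ltW p0) ?powR_ge0//.
  by rewrite addr_ge0 ?powR_ge0 ?sumr_ge0// => i _; exact: powR_ge0.
by rewrite lerDl sumr_ge0// => i _; exact: powR_ge0.
Qed.

(** The unit ball of the dual of [l_p^m], described by its action instead of the conjugate exponent.
    The bound on the coordinates places them in the cells of [unit_ball_cells]. *)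
Definition dual_unit_ball m (c : nat -> K) :=
  (forall j : 'I_m, rnorm (c j : K^o) <= 1) /\
  forall b : nat -> K, rnorm (\sum_(j < m) c j * b j : K^o) <= lp_norm m b.

Lemma dual_unit_ball0 m : dual_unit_ball m (fun=> 0).
Proof.
split=> [j|b]; first by rewrite (@rnorm0 _ _ K^o).
by rewrite big1 ?(@rnorm0 _ _ K^o) ?powR_ge0// => j _; rewrite mul0r.
Qed.

Lemma dual_unit_ball_norming m (b : nat -> K) :
  exists2 c, dual_unit_ball m c & \sum_(j < m) c j * b j = to_scalars (lp_norm m b).
Proof.
have [s [s0 s1] sE] := @hoelder_extremal R p p1 _ (index_enum 'I_m)
  (fun j => rnorm (b j : K^o)) (fun j => rnorm_ge0 _).
have /boolp.choice[u uP] (j : nat) : exists v : K, rnorm (v : K^o) = 1 /\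
    v * b j = to_scalars (rnorm (b j : K^o)).
  by have [v ? ?] := phase (b j); exists v.
(* The weights, indexed by ordinals, are extended by 0 to all of [nat]. *)
pose s' j : R := if insub j is Some j' then s (j' : 'I_m) else 0.
have s'E (j : 'I_m) : s' j = s j by rewrite /s' valK.
pose c j : K := to_scalars (s' j `^ (1 - p^-1)) * u j.
have cn j : rnorm (c j : K^o) = s' j `^ (1 - p^-1).
  by rewrite rnormM (uP j).1 mulr1 rnorm_to_scalars ger0_norm// powR_ge0.
exists c; last first.
  rewrite /lp_norm -sE; under eq_bigr do rewrite -mulrA (uP _).2 -to_scalarsM s'E.
  by rewrite -(big_morph _ (@to_scalarsD R k) (@to_scalars0 R k)).
split=> [j|b'].
  rewrite cn s'E -[leRHS](_ : 1 `^ (1 - p^-1) = 1); last by rewrite powR1.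
  apply: ge0_ler_powR.
  - by have /andP[] := conj_exp_itv p1.
  - by rewrite nnegrE.
  - by rewrite nnegrE.
  - by apply: le_trans s1; rewrite (bigD1 j)//= lerDl sumr_ge0.
apply: le_trans (@rnorm_sum R k K^o _ _ _ _) _.
under eq_bigr do rewrite rnormM cn s'E.
apply: (sum_hoelder1 p1 (fun i _ => s0 i) _ s1) => i _; exact: rnorm_ge0.
Qed.

(** Sort the dual unit ball by the cells of the coordinates and keep one point for each pattern of
    cells. The point that shares its pattern with an exact norming vector of [b] norms [b] up to a
    small error. *)
Lemma finite_norming_set m (e : R) : 0 < e -> exists (M : nat) (d : nat -> nat -> K),
  (forall i, dual_unit_ball m (d i)) /\
  forall b : nat -> K, exists2 i, (i < M)%N &
    lp_norm m b <= (1 + e) * re (\sum_(j < m) d i j * b j).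
Proof.
(* The total error is at most [e' m] times the norm of [b], and
   [e' m <= e / (1 + e) = 1 - 1 / (1 + e)]; the successor of [m] avoids a zero denominator. *)
move=> e0; pose e' := e / ((1 + e) * m.+1%:R).
have e1 : 0 < 1 + e by rewrite addr_gt0.
have e'0 : 0 < e' by rewrite divr_gt0// mulr_gt0// ltr0n.
have [F [cell cellP]] := unit_ball_cells e'0.
pose C (c : nat -> K) : {ffun 'I_m -> F} := [ffun j : 'I_m => cell (c j)].
(* A pattern that no point of the dual unit ball has is represented by 0. *)
have /boolp.choice[d0 d0P] i : exists d, dual_unit_ball m d /\
    forall c, dual_unit_ball m c -> C c = i -> C d = i.
  have [[c [cb ci]]|no] := pselect (exists c, dual_unit_ball m c /\ C c = i).
    by exists c; split=> // c' _.
  exists (fun=> 0); split; first exact: dual_unit_ball0.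
  by move=> c cb ci; exfalso; apply: no; exists c.
pose enc i : {ffun 'I_m -> F} := nth (C (fun=> 0)) (enum {: {ffun 'I_m -> F}}) i.
exists #|{: {ffun 'I_m -> F}}|, (fun i => d0 (enc i)); split=> [i|b].
  exact: (d0P _).1.
have [c cb cE] := dual_unit_ball_norming m b.
exists (enum_rank (C c)); first exact: ltn_ord.
have -> : enc (enum_rank (C c)) = C c.
  by rewrite /enc -[RHS](enum_rankK (C c)) (enum_val_nth (C (fun=> 0))).
set d := d0 (C c).
have [db /(_ c cb erefl) dC] := d0P (C c).
have near (j : 'I_m) : rnorm (c j - d j : K^o) <= e'.
  apply: cellP; [exact: cb.1|exact: db.1|].
  by have := congr1 (fun f : {ffun 'I_m -> F} => f j) dC; rewrite !ffunE.
have N0 : 0 <= lp_norm m b by exact: powR_ge0.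
have cd : \sum_(j < m) c j * b j =
    \sum_(j < m) d j * b j + \sum_(j < m) (c j - d j) * b j.
  by rewrite -big_split; apply: eq_bigr => j _; rewrite /= -mulrDl addrC subrK.
have err : re (\sum_(j < m) (c j - d j) * b j) <= e' * m%:R * lp_norm m b.
  apply: le_trans (scalars_re_le_rnorm _) _.
  apply: le_trans (@rnorm_sum R k K^o _ _ _ _) _.
  apply: (@le_trans _ _ (\sum_(j < m) e' * lp_norm m b)).
    apply: ler_sum => j _; rewrite rnormM ler_pM ?rnorm_ge0//; exact: lp_norm_ge.
  by rewrite sumr_const card_ord -[leLHS]mulr_natr mulrAC.
have : lp_norm m b <= re (\sum_(j < m) d j * b j) + e' * m%:R * lp_norm m b.
  rewrite -[leLHS](@to_scalarsK R k) -cE cd scalars_reD; exact: lerD.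
have em : e' * m%:R <= e / (1 + e).
  rewrite /e' invfM mulrA -mulrA ger_pMr ?divr_gt0// mulrC ler_pdivrMr ?ltr0n//.
  by rewrite mul1r ler_nat.
move=> h; rewrite mulrC -ler_pdivrMr//.
have : lp_norm m b / (1 + e) = lp_norm m b - e / (1 + e) * lp_norm m b.
  by field; rewrite gt_eqF.
move=> ->; rewrite lerBlDr; apply: le_trans h _.
by rewrite lerD2l ler_wpM2r.
Qed.

End norming_set.

(** * Mid norms in the bidual *)

Section bidual.
Context {R : realType} {k : base_field}.
Notation K := (scalars R k).
Notation re := (@scalars_re R k).

Lemma dualZ (V : normedModType K) (f : dual V) (a : K) (v : V) : f (a *: v) = a * f v.
Proof. exact: linearZ. Qed.

Lemma dual_sumE (V : normedModType K) (I : Type) (l : seq I) (P : pred I)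
  (F : I -> dual V) (v : V) :
  (\sum_(i <- l | P i) F i : dual V) v = \sum_(i <- l | P i) F i v.
Proof. exact: (big_morph (fun f : dual V => f v)). Qed.

Lemma rnorm_dual_le (V : normedModType K) (f : dual V) (c : R) : 0 <= c ->
  rnorm f <= c <-> forall v, rnorm (f v) <= c * rnorm v.
Proof.
rewrite rnorm_dual => c0; split=> [fc v|fc].
  by apply: le_trans (dual_norm_ub _ _) _; rewrite ler_wpM2r ?rnorm_ge0.
by apply: dual_norm_le => v v1; apply: le_trans (fc v) _; rewrite ler_piMr.
Qed.

Lemma evaluation_subproof (V : normedModType K) (v : V) :
  (fun f : dual V => f v) \in dual_pred (dual V).
Proof.
apply: (@dual_pred_bounded _ _ _ _ (rnorm v)) => // f.
by rewrite rnorm_dual mulrC; exact: (dual_norm_ub f v).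
Qed.

Definition evaluation (V : normedModType K) (v : V) : dual (dual V) :=
  Dual (evaluation_subproof v).

Lemma rnorm_evaluation (V : normedModType K) (v : V) : rnorm (evaluation v) <= rnorm v.
Proof.
apply/rnorm_dual_le => [|f]; first exact: rnorm_ge0.
by rewrite rnorm_dual mulrC; exact: (dual_norm_ub f v).
Qed.

Lemma dual_re_le0 (V : normedModType K) (f : dual V) :
  (forall v, re (f v) <= 0) -> f = 0.
Proof.
move=> f0; apply/val_inj/funext => v /=; apply: rnorm0_eq0; apply/eqP.
rewrite eq_le rnorm_ge0 andbT.
have [u _ uf] := phase (f v).
by rewrite -[leLHS](@to_scalarsK R k) -uf -dualZ.
Qed.

Variables (p : R) (p1 : 1 <= p).
Let p0 : 0 < p. Proof. exact: lt_le_trans p1. Qed.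
Let r := 1 - p^-1.

(** The unit ball of the weakly p-summable sequences in the dual, tested on [V] instead of the
    bidual; [weak_boundedP] shows that the two tests agree. *)
Definition weak_bounded (V : normedModType K) (h : nat -> dual V) :=
  forall v N, \sum_(n < N) rnorm (h n v) `^ p <= rnorm v `^ p.

Lemma lp_norm_powR m (b : nat -> K) :
  lp_norm p m b `^ p = \sum_(j < m) rnorm (b j : K^o) `^ p.
Proof.
rewrite /lp_norm -powRrM mulVf ?gt_eqF// powRr1// sumr_ge0// => j _.
exact: powR_ge0.
Qed.

Lemma ler_powRp (a b : R) : 0 <= a -> 0 <= b -> (a `^ p <= b `^ p) = (a <= b).
Proof.
move=> a0 b0; apply/idP/idP; last first.
  by move=> ab; apply: ge0_ler_powR; rewrite ?nnegrE// ltW.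
by apply: contraTT; rewrite -!ltNge => ba; apply: gt0_ltr_powR; rewrite ?nnegrE.
Qed.

(** Write the [l_p] norm of the [th (h n)] as [th] of a combination of the [h n] with coefficients
    in the dual unit ball. This combination is a functional on [V] of norm at most 1, as evaluation
    at each [v] shows. *)
Lemma weak_bounded_bidual (V : normedModType K) (h : nat -> dual V)
    (th : dual (dual V)) N : weak_bounded h ->
  \sum_(n < N) rnorm (th (h n)) `^ p <= rnorm th `^ p.
Proof.
move=> hw; have [c cb cE] := dual_unit_ball_norming p1 N (fun n => th (h n)).
rewrite -(lp_norm_powR N (fun n => th (h n))).
rewrite ler_powRp ?powR_ge0 ?rnorm_ge0// -[leLHS](@to_scalarsK R k) -cE.
have -> : \sum_(j < N) c j * th (h j) = th (\sum_(j < N) c j *: h j).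
  by rewrite linear_sum; apply: eq_bigr => j _; rewrite linearZ.
apply: le_trans (scalars_re_le_rnorm _) _.
have /(rnorm_dual_le _ (rnorm_ge0 _)) th1 := lexx (rnorm th).
apply: le_trans (th1 _) _; rewrite -[leRHS]mulr1 ler_wpM2l ?rnorm_ge0//.
apply/rnorm_dual_le => // v.
rewrite dual_sumE mul1r; apply: le_trans (cb.2 (fun j => h j v)) _.
by rewrite -ler_powRp ?rnorm_ge0 ?powR_ge0// lp_norm_powR.
Qed.

Lemma weak_boundedP (V : normedModType K) (h : nat -> dual V) :
  weak_bounded h <-> forall th : dual (dual V), rnorm th <= 1 ->
    forall N, \sum_(n < N) rnorm (th (h n)) `^ p <= 1.
Proof.
split=> [hw th th1 N|hw v N].
  apply: le_trans (weak_bounded_bidual th N hw) _.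
  rewrite -[leRHS](_ : 1 `^ p = 1); last by rewrite powR1.
  by rewrite ler_powRp ?rnorm_ge0.
have [v0|v0] := eqVneq (rnorm v) 0.
  rewrite (rnorm0_eq0 v0) rnorm0 powR0 ?gt_eqF// big1// => n _.
  by rewrite linear0 rnorm0 powR0 ?gt_eqF.
have vp : 0 < rnorm v by rewrite lt_neqAle eq_sym v0 rnorm_ge0.
have u1 : rnorm (evaluation (to_scalars (rnorm v)^-1 *: v)) <= 1.
  apply: le_trans (rnorm_evaluation _) _.
  by rewrite rnormZ rnorm_to_scalars ger0_norm ?invr_ge0 ?rnorm_ge0// mulVf.
rewrite -[leRHS]mulr1 -ler_pdivrMl ?powR_gt0//.
apply: le_trans (hw _ u1 N); rewrite mulr_sumr; apply: ler_sum => n _.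
rewrite /= linearZ rnormZ rnorm_to_scalars ger0_norm ?invr_ge0 ?rnorm_ge0//.
rewrite [in leRHS]powRM ?invr_ge0 ?rnorm_ge0//.
by rewrite -powR_inv1 ?rnorm_ge0// -powRrM mulN1r powRN.
Qed.

(** * Competitors split into cells *)

Section mean_argument.
Variables (V : normedModType K) (m M : nat) (d : nat -> nat -> K).

(* A competitor in the supremum that defines the mid norm of a tuple [x]: the
   coefficients of the [f n (x j)] are [s n `^ (1 - 1/p) * d (i n) j]. *)
Record competitor := Competitor {
  cN : nat ; cf : nat -> dual V ; cs : nat -> R ; ci : nat -> nat ;
  cfw : weak_bounded cf ; cs0 : forall n, 0 <= cs n ;
  cs1 : \sum_(n < cN) cs n <= 1 ; ciM : forall n, (ci n < M)%N }.

Definition cell_sum (i : nat) (F : competitor -> nat -> R) (w : competitor) : R^o :=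
  \sum_(n < cN w | ci w n == i) F w n.

(** This and the next two are functions of the competitor, to be averaged separately; Hoelder's
    inequality bounds the value by the mass and the weak sum of the same cell. *)
Definition cell_value i (v : V) :=
  cell_sum i (fun w n => cs w n `^ r * re (cf w n v)).
Definition cell_mass i := cell_sum i cs.
Definition cell_weak i (v : V) := cell_sum i (fun w n => rnorm (cf w n v) `^ p).

(** Here [N] is unrelated to [M]: an index [n] is counted once if [ci w n < N], and otherwise not at
    all. *)
Lemma sum_cell_le N (F : competitor -> nat -> R) (w : competitor) :
  (forall n, 0 <= F w n) ->
  \sum_(i < N) cell_sum i F w <= \sum_(n < cN w) F w n.
Proof.
move=> F0; rewrite /cell_sum (exchange_big_dep xpredT)//=.
apply: ler_sum => n _; rewrite sumr_const -[leRHS]mulr1n.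
apply: ler_wpMn2l => //.
apply: (@leq_trans #|[pred j : 'I_N | val j == ci w n]|).
  by apply: subset_leq_card; apply/fintype.subsetP => j; rewrite !inE eq_sym.
apply/card_le1_eqP => a b; rewrite !inE => /eqP a1 /eqP b1; apply: val_inj.
by rewrite /= a1 b1.
Qed.

Lemma sum_cell (F : competitor -> nat -> R) (w : competitor) :
  \sum_(i < M) cell_sum i F w = \sum_(n < cN w) F w n.
Proof.
rewrite [RHS](partition_big (fun n : 'I__ => Ordinal (ciM w n)) xpredT)//=.
Qed.

Lemma cell_mass_ge0 i w : 0 <= cell_mass i w.
Proof. by apply: sumr_ge0 => n _; exact: cs0. Qed.

Lemma cell_weak_ge0 i v w : 0 <= cell_weak i v w.
Proof. by apply: sumr_ge0 => n _; exact: powR_ge0. Qed.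

Lemma cell_mass_le N w : \sum_(i < N) cell_mass i w <= 1.
Proof. exact: le_trans (sum_cell_le _ (cs0 w)) (cs1 w). Qed.

Lemma cell_weak_le N v w : \sum_(i < N) cell_weak i v w <= rnorm v `^ p.
Proof.
by apply: le_trans (sum_cell_le _ (fun n => powR_ge0 _ _)) (cfw w v _).
Qed.

Lemma single_cell_le (F : nat -> competitor -> R) c w i :
  (forall i, 0 <= F i w) -> (forall N, \sum_(i < N) F i w <= c) -> F i w <= c.
Proof.
move=> F0 Fc; apply: le_trans (Fc i.+1); rewrite big_ord_recr /= lerDr.
by rewrite sumr_ge0.
Qed.

(** Hoelder's inequality on a cell in its linear form, which a mean preserves. *)
Lemma cell_value_young i v w c e : 0 < c -> 0 < e -> c `^ r * e `^ (1 - r) = 1 ->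
  cell_value i v w <= r * c * cell_mass i w + (1 - r) * e * cell_weak i v w.
Proof.
move=> c0 e0 ce; rewrite !mulr_sumr -big_split; apply: ler_sum => n _ /=.
have := @weighted_young R r c e (cs w n) (rnorm (cf w n v) `^ p) (conj_exp_itv p1).
move=> /(_ c0 e0 ce (cs0 w n) (powR_ge0 _ _)); apply: le_trans.
rewrite powR_conj_exp ?rnorm_ge0// ler_wpM2l ?powR_ge0//.
exact: scalars_re_le_rnorm.
Qed.

Lemma cell_valueD i u v : cell_value i (u + v) = cell_value i u + cell_value i v.
Proof.
apply/funext => w; rewrite /cell_value /cell_sum !fctE -big_split.
by apply: eq_bigr => n _; rewrite linearD scalars_reD mulrDr.
Qed.

Lemma cell_valueZ i a v : cell_value i (to_scalars a *: v) = a *: cell_value i v.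
Proof.
apply/funext => w; rewrite /cell_value /cell_sum !fctE scaler_sumr.
by apply: eq_bigr => n _; rewrite linearZ scalars_reZ mulrCA.
Qed.

Lemma cell_weak_phase i (u : K) v : rnorm (u : K^o) = 1 ->
  cell_weak i (u *: v) = cell_weak i v.
Proof.
move=> u1; apply/funext => w; apply: eq_bigr => n _.
by rewrite linearZ rnormZ u1 mul1r.
Qed.

Lemma cell_value_abs i v w : `|cell_value i v w| <= rnorm v.
Proof.
apply: le_trans (ler_norm_sum _ _ _) _.
apply: (@le_trans _ _ (\sum_(n < cN w | ci w n == i)
    cs w n `^ r * rnorm (cf w n v))).
  apply: ler_sum => n _; rewrite normrM ger0_norm ?powR_ge0//.
  by rewrite ler_wpM2l ?powR_ge0// scalars_re_le.
apply: le_trans (sum_hoelder1 p1 _ _ _) _.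
- by move=> n _; exact: cs0.
- by move=> n _; exact: rnorm_ge0.
- exact: (@single_cell_le cell_mass 1 w i (cell_mass_ge0 ^~ w) (cell_mass_le ^~ w)).
rewrite -[leRHS]powRr1 ?rnorm_ge0// -(@mulfV _ p) ?gt_eqF// powRrM.
apply: ge0_ler_powR; rewrite ?nnegrE ?invr_ge0 ?(ltW p0) ?powR_ge0//.
  exact: (cell_weak_ge0 i v w).
apply: (@single_cell_le (cell_weak ^~ v) _ w i).
  by move=> j; exact: cell_weak_ge0.
by move=> N; exact: cell_weak_le.
Qed.

Lemma cell_value_bounded i v : cell_value i v \in @bounded_function R competitor.
Proof. by apply/bounded_functionP; exists (rnorm v) => w; exact: cell_value_abs. Qed.

Lemma cell_mass_bounded i : cell_mass i \in @bounded_function R competitor.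
Proof.
apply/bounded_functionP; exists 1 => w; rewrite ger0_norm ?cell_mass_ge0//.
exact: (@single_cell_le cell_mass 1 w i (cell_mass_ge0 ^~ w) (cell_mass_le ^~ w)).
Qed.

Lemma cell_weak_bounded i v : cell_weak i v \in @bounded_function R competitor.
Proof.
apply/bounded_functionP; exists (rnorm v `^ p) => w.
rewrite ger0_norm ?cell_weak_ge0//; apply: (@single_cell_le (cell_weak ^~ v) _ w i).
  by move=> j; exact: cell_weak_ge0.
by move=> N; exact: cell_weak_le.
Qed.

Definition mid_value (x : nat -> V) : competitor -> R^o :=
  \sum_(i < M) cell_value i (\sum_(j < m) d i j *: x j).

Lemma mid_value_bounded x : mid_value x \in @bounded_function R competitor.
Proof. by apply: rpred_sum => i _; exact: cell_value_bounded. Qed.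

End mean_argument.
End bidual.

(** * Representation by averages and passage to the bidual *)

Section bidual_mid.
Context {R : realType} {k : base_field}.
Notation K := (scalars R k).
Notation re := (@scalars_re R k).
Variables (p : R) (p1 : 1 <= p).
Let p0 : 0 < p. Proof. exact: lt_le_trans p1. Qed.
Let r := 1 - p^-1.
Let r01 : 0 <= r < 1. Proof. exact: conj_exp_itv. Qed.
Let r1E : 1 - r = p^-1. Proof. by rewrite /r; ring. Qed.

Definition mid_bounded (V : normedModType K) m (x : nat -> V) (c : R) :=
  forall f : nat -> dual V, weak_bounded p f ->
  forall N, \sum_(n < N) \sum_(j < m) rnorm (f n (x j)) `^ p <= c `^ p.

(** Given [f], choose for each [n] a vector [d (i n)] that almost norms the tuple of the
    [f n (x j)], and take for [s] the extremal Hoelder weights. The value at this competitor is, up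
    to the factor [1 + e], at least the p-th root of the mid sum. *)
Lemma mid_value_le (V : normedModType K) m M (d : nat -> nat -> K) (e : R) (x : nat -> V) c :
  0 <= 1 + e ->
  (forall b : nat -> K, exists2 i, (i < M)%N &
     lp_norm p m b <= (1 + e) * re (\sum_(j < m) d i j * b j)) ->
  0 <= c -> (forall w : competitor p V M, mid_value m d x w <= c) ->
  mid_bounded m x ((1 + e) * c).
Proof.
move=> e0 dN c0 xc f fw N.
have /boolp.choice[i iP] (n : nat) : exists i, (i < M)%N /\
    lp_norm p m (fun j => f n (x j)) <= (1 + e) * re (\sum_(j < m) d i j * f n (x j)).
  by have [i iM ib] := dN (fun j => f n (x j)); exists i.
have [s [s0 s1] sE] := @hoelder_extremal R p p1 _ (index_enum 'I_N)
  (fun n => lp_norm p m (fun j => f n (x j))) (fun n => powR_ge0 _ _).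
pose s' n : R := if insub n is Some n' then s (n' : 'I_N) else 0.
have s'E (n : 'I_N) : s' n = s n by rewrite /s' valK.
have s'0 n : 0 <= s' n by rewrite /s'; case: insub.
have s'1 : \sum_(n < N) s' n <= 1 by under eq_bigr do rewrite s'E.
pose w := @Competitor R k p V M N f s' i fw s'0 s'1 (fun n => (iP n).1).
have wE : mid_value m d x w =
    \sum_(n < N) s n `^ r * re (\sum_(j < m) d (i n) j * f n (x j)).
  rewrite /mid_value fct_sumE.
  rewrite (eq_bigr (fun a : 'I_M => cell_sum a (fun w n => cs w n `^ r *
      re (\sum_(j < m) d (ci w n) j * cf w n (x j))) w)); last first.
    move=> a _; apply: eq_bigr => n /eqP <-; congr (_ * re _).
    by rewrite linear_sum; apply: eq_bigr => j _; rewrite linearZ.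
  by rewrite sum_cell; apply: eq_bigr => n _; rewrite -s'E.
under eq_bigr do rewrite -(lp_norm_powR p1 m (fun j => f _ (x j))).
have -> : \sum_(n < N) lp_norm p m (fun j => f n (x j)) `^ p =
    ((\sum_(n < N) lp_norm p m (fun j => f n (x j)) `^ p) `^ p^-1) `^ p.
  by rewrite -powRrM mulVf ?gt_eqF// powRr1// sumr_ge0// => n _; exact: powR_ge0.
rewrite ler_powRp ?powR_ge0 ?mulr_ge0// -sE.
apply: le_trans (ler_wpM2l e0 (xc w)); rewrite wE mulr_sumr.
apply: ler_sum => n _; rewrite mulrCA ler_wpM2l ?powR_ge0//.
exact: (iP n).2.
Qed.

Lemma mean_sum (I : Type) (mu : (I -> R^o) -> R) :
  {in @bounded_function R I &, forall u v, mu (u + v) = mu u + mu v} ->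
  (forall a, {in @bounded_function R I, forall u, mu (a *: u) = a * mu u}) ->
  forall N (F : nat -> I -> R^o), (forall i, F i \in @bounded_function R I) ->
  mu (\sum_(i < N) F i) = \sum_(i < N) mu (F i).
Proof.
move=> muD muZ N F Fb; elim: N => [|N IH].
  by rewrite !big_ord0 -(scale0r (0 : I -> R^o)) muZ ?mul0r// rpred0.
by rewrite !big_ord_recr /= muD ?IH// rpred_sum.
Qed.

(* [g] is a combination, with coefficients from a finite norming set, of
   functionals [h i] obtained by averaging the competitors. *)
Lemma mid_representation (V : normedModType K) m M (d : nat -> nat -> K)
    (g : nat -> dual V) C : (0 < M)%N -> 0 < C ->
  (forall (x : nat -> V) c, 0 <= c ->
     (forall w : competitor p V M, mid_value m d x w <= c) ->
     re (\sum_(j < m) g j (x j)) <= C * c) ->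
  exists h : nat -> dual V, exists2 s : nat -> R, weak_bounded p h &
    [/\ forall i, 0 <= s i, \sum_(i < M) s i <= 1 &
    forall j, (j < m)%N -> g j =
      \sum_(i < M) to_scalars (C * s i `^ r) * d i j *: h i].
Proof.
move=> M0 C0 gC.
pose W := competitor p V M.
pose bf := @bounded_function R W.
pose gamma (x : nat -> V) := re (\sum_(j < m) g j (x j)).
(* The competitor without terms, [w0], shows that competitors exist and that every upper bound of
   [mid_value] is nonnegative. *)
have zw : weak_bounded p (fun=> 0 : dual V).
  move=> v N; rewrite big1 ?powR_ge0// => n _.
  by rewrite (_ : (0 : dual V) v = 0)// rnorm0 powR0 ?gt_eqF.
have s00 : \sum_(n < 0) (0 : R) <= 1 by rewrite big_ord0.
pose w0 : W := Competitor zw (fun=> lexx 0) s00 (fun=> M0).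
have w00 x : mid_value m d x w0 = 0.
  rewrite /mid_value fct_sumE big1// => i _.
  by rewrite /cell_value /cell_sum big_mkcond big_ord0.
have mvD x y : mid_value m d (x + y) = mid_value m d x + mid_value m d y :> (W -> R^o).
  rewrite /mid_value -big_split; apply: eq_bigr => i _ /=.
  rewrite -cell_valueD; congr cell_value; rewrite -big_split.
  by apply: eq_bigr => j _; rewrite /= -scalerDr.
have mvZ a x : mid_value m d (fun j => to_scalars a *: x j) =
    a *: mid_value m d x :> (W -> R^o).
  rewrite /mid_value scaler_sumr; apply: eq_bigr => i _ /=.
  rewrite -cell_valueZ; congr cell_value; rewrite scaler_sumr.
  by apply: eq_bigr => j _; rewrite !scalerA mulrC.
have gammaD x y : gamma (x + y) = gamma x + gamma y.
  rewrite -scalars_reD -big_split; congr re; apply: eq_bigr => j _ /=.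
  by rewrite -linearD.
have gammaZ a x : gamma (fun j => to_scalars a *: x j) = a * gamma x.
  rewrite -scalars_reZ mulr_sumr; congr re; apply: eq_bigr => j _ /=.
  by rewrite dualZ.
(* The mean has to give [C *: mid_value m d x] at least the value [gamma x]; by [gC] these demands
   lie below the supremum. *)
pose G : set ((W -> R^o) * R) := [set u | exists x, u = (C *: mid_value m d x, gamma x)].
have [||||| mu [muD muZ muc muG]] := @exists_mean R W w0 G.
- exists (fun=> 0); rewrite (_ : (fun=> 0) = (fun j : nat => to_scalars 0 *: (0 : V))).
    by rewrite mvZ gammaZ scale0r scaler0 mul0r.
  by apply/funext => j; rewrite scaler0.
- by move=> _ _ [x ->] [y ->]; exists (x + y); rewrite mvD gammaD scalerDr.
- move=> a _ a0 [x ->]; exists (fun j => to_scalars a *: x j).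
  by rewrite mvZ gammaZ /= !scalerA mulrC.
- by move=> _ [x ->]; apply: rpredZ; exact: mid_value_bounded.
- move=> _ c [x ->] /= xc.
  have c0 : 0 <= c by have := xc w0; rewrite /= !fctE w00 scaler0.
  rewrite -[c](mulfVK (lt0r_neq0 C0)) mulrC; apply: gC; first by rewrite divr_ge0// ltW.
  by move=> w; rewrite ler_pdivlMr// mulrC; exact: xc.
have cm i := @cell_mass_bounded R k p V M i.
have cw i v := @cell_weak_bounded R k p V M i v.
have cv i v := @cell_value_bounded R k p p1 V M i v.
have muN u : u \in bf -> mu (- u) = - mu u.
  by move=> ub; rewrite -scaleN1r muZ// mulN1r.
have mu_ge0 u : u \in bf -> (forall w, 0 <= u w) -> 0 <= mu u.
  move=> ub u0; rewrite -oppr_le0 -muN//; apply: muc; first by rewrite rpredN.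
  by move=> w; rewrite oppr_le0.
have mu_le u v : u \in bf -> v \in bf -> (forall w, u w <= v w) -> mu u <= mu v.
  move=> ub vb uv; rewrite -subr_ge0 -muN// -muD ?rpredN//.
  by apply: mu_ge0 => [|w]; rewrite ?rpredB// subr_ge0.
pose s i := mu (cell_mass i).
pose t i v := mu (cell_weak i v).
pose rho i v := mu (cell_value i v).
have s0 i : 0 <= s i by apply: mu_ge0 => // w; exact: cell_mass_ge0.
have t0 i v : 0 <= t i v by apply: mu_ge0 => // w; exact: cell_weak_ge0.
(* Hoelder's inequality for the mean: [cell_value_young] is averaged with fixed weights, which are
   then optimised. *)
have rho_le i v : rho i v <= s i `^ r * t i v `^ (1 - r).
  apply: le_geometric_mean => // c e c0 e0 ce.
  rewrite /s /t -!muZ// -muD ?rpredZ//; apply: mu_le => // [|w].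
    by rewrite rpredD ?rpredZ.
  exact: cell_value_young.
(* The functional with real part [rho i]. The bound passes from real parts to moduli because
   [cell_weak] does not change when [v] is rotated by a phase. *)
have /boolp.choice[h0 h0P] i : exists h : dual V,
    (forall v, re (h v) = rho i v) /\ forall v, rnorm (h v) <= s i `^ r * t i v `^ (1 - r).
  have [||| h hre _] := @dual_of_re R k V (rho i) 1.
  - by move=> u v; rewrite /rho cell_valueD muD.
  - by move=> a v; rewrite /rho cell_valueZ muZ.
  - move=> v; rewrite mul1r; apply: muc => // w.
    by apply: le_trans (ler_norm _) _; exact: cell_value_abs.
  exists h; split=> // v; have [u u1 uh] := phase (h v).
  rewrite -[leLHS](@to_scalarsK R k) -uh -dualZ hre.
  by apply: le_trans (rho_le _ _) _; rewrite /t cell_weak_phase.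
(* If [s i ^ r = 0], the bound forces [h0 i = 0], so the convention that the inverse of 0 is 0 is
   harmless. *)
pose h i := to_scalars (s i `^ r)^-1 *: h0 i : dual V.
have hE i : h0 i = to_scalars (s i `^ r) *: h i.
  rewrite scalerA -to_scalarsM; have [sr|sr] := eqVneq (s i `^ r) 0.
    rewrite sr mul0r to_scalars0 scale0r; apply: dual_re_le0 => v.
    apply: le_trans (scalars_re_le_rnorm _) _.
    by apply: le_trans ((h0P i).2 v) _; rewrite sr mul0r.
  by rewrite divff// to_scalars1 scale1r.
exists h, s.
  (* After the normalisation [|h i v|^p <= t i v], and the [t i v] sum to the mean of a function
     bounded by [|v|^p]. *)
  move=> v N; apply: (@le_trans _ _ (\sum_(i < N) t i v)).
    apply: ler_sum => i _.
    have -> : h i v = to_scalars (s i `^ r)^-1 * h0 i v by [].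
    rewrite rnormM rnorm_to_scalars ger0_norm ?invr_ge0 ?powR_ge0//.
    have [sr|sr] := eqVneq (s i `^ r) 0.
      by rewrite sr invr0 mul0r powR0 ?gt_eqF.
    rewrite -[leRHS]powRr1// -(@mulVf _ p) ?gt_eqF// powRrM.
    rewrite ler_powRp ?powR_ge0 ?mulr_ge0 ?invr_ge0 ?powR_ge0 ?rnorm_ge0//.
    rewrite mulrC ler_pdivrMr; last by rewrite lt_neqAle eq_sym sr powR_ge0.
    by rewrite mulrC -r1E; exact: (h0P i).2.
  rewrite -(mean_sum muD muZ _ (cw ^~ v)); apply: muc; first by rewrite rpred_sum.
  by move=> w; rewrite fct_sumE; exact: cell_weak_le.
split=> //.
  rewrite -(mean_sum muD muZ _ cm); apply: muc; first by rewrite rpred_sum.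
  by move=> w; rewrite fct_sumE; exact: cell_mass_le.
move=> j jm; apply/eqP; rewrite -subr_eq0; apply/eqP; apply: dual_re_le0 => v.
(* Since [v] is arbitrary, one inequality between real parts suffices; it is [muG] for the tuple
   with [v] in place [j] and 0 elsewhere. *)
pose x j' := if j' == j then v else 0.
have xE (W' : zmodType) (F : nat -> V -> W') : (forall j', F j' 0 = 0) ->
    \sum_(j' < m) F j' (x j') = F j v.
  move=> F0; rewrite (bigD1 (Ordinal jm))//= {1}/x eqxx big1 ?addr0// => i ij.
  by rewrite /x ifN ?F0//; apply: contra ij => /eqP ij; apply/eqP/val_inj.
have -> : (g j - \sum_(i < M) to_scalars (C * s i `^ r) * d i j *: h i : dual V) v =
    g j v - (\sum_(i < M) to_scalars (C * s i `^ r) * d i j *: h i : dual V) v by [].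
rewrite scalars_reB subr_le0.
have := muG (C *: mid_value m d x, gamma x); rewrite /G/= => /(_ (ex_intro _ x erefl)).
rewrite /gamma (xE _ (fun j v => g j v)); last by move=> j'; rewrite linear0.
move=> /le_trans; apply; rewrite muZ; last exact: mid_value_bounded.
rewrite /mid_value (@mean_sum W mu muD muZ M
  (fun i => cell_value i (\sum_(j < m) d i j *: x j)))// mulr_sumr dual_sumE scalars_re_sum.
apply: ler_sum => i _; rewrite (xE _ (fun j' v => d i j' *: v)); last first.
  by move=> j'; rewrite scaler0.
rewrite -/(rho i _) -(h0P i).1 dualZ hE.
have -> : (to_scalars (C * s i `^ r) * d i j *: h i : dual V) v =
  to_scalars (C * s i `^ r) * d i j * h i v by [].
have -> : (to_scalars (s i `^ r) *: h i : dual V) v = to_scalars (s i `^ r) * h i v by [].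
by rewrite -scalars_reZ to_scalarsM -!mulrA [d i j * (_ * _)]mulrCA.
Qed.

Lemma mid_bidual (V : normedModType K) m (g : nat -> dual V) C : 0 < C ->
  (forall x c, 0 <= c -> mid_bounded m x c -> re (\sum_(j < m) g j (x j)) <= C * c) ->
  forall phi : nat -> dual (dual V),
  (forall h, weak_bounded p h ->
     forall N, \sum_(n < N) \sum_(j < m) rnorm (phi j (h n)) `^ p <= 1) ->
  re (\sum_(j < m) phi j (g j)) <= C.
Proof.
move=> C0 gC phi phi1; apply/ler_addgt0Pr => e0 e00.
(* Chosen so that [C (1 + e) = C + e0]. *)
pose e := e0 / C; have e_gt0 : 0 < e by rewrite divr_gt0.
have e1 : 0 < 1 + e by rewrite addr_gt0.
have [M [d [db dN]]] := @finite_norming_set R k p p1 m e e_gt0.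
have M0 : (0 < M)%N by have [i iM _] := dN (fun=> 0); exact: leq_ltn_trans (leq0n i) iM.
have [|x c c0 xc|h [s hw [s0 s1 gE]]] :=
    @mid_representation V m M d g (C * (1 + e)) M0.
- exact: mulr_gt0.
- rewrite -mulrA; apply: gC; first by rewrite mulr_ge0// ltW.
  exact: (mid_value_le (ltW e1) dN c0 xc).
have -> : C + e0 = C * (1 + e) by rewrite /e; field; rewrite gt_eqF.
have -> : re (\sum_(j < m) phi j (g j)) =
    \sum_(i < M) C * (1 + e) * (s i `^ r * re (\sum_(j < m) d i j * phi j (h i))).
  rewrite scalars_re_sum; under [RHS]eq_bigr do rewrite scalars_re_sum !mulr_sumr.
  rewrite exchange_big /=; apply: eq_bigr => j _.
  rewrite gE ?ltn_ord// linear_sum /= scalars_re_sum; apply: eq_bigr => i _.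
  by rewrite dualZ -mulrA scalars_reZ mulrA.
rewrite -mulr_sumr -[leRHS]mulr1 ler_wpM2l ?mulr_ge0 ?(ltW C0) ?(ltW e1)//.
(* As [d i] lies in the dual unit ball, the inner sum is at most an [l_p] norm. Hoelder's inequality
   in [i] then leaves the mid sum of [phi] tested on [h]. *)
apply: (@le_trans _ _ (\sum_(i < M) s i `^ r * lp_norm p m (fun j => phi j (h i)))).
  apply: ler_sum => i _; rewrite ler_wpM2l ?powR_ge0//.
  exact: le_trans (scalars_re_le_rnorm _) ((db i).2 _).
apply: le_trans (@sum_hoelder1 R p p1 _ (index_enum 'I_M) xpredT (fun i => s i)
  (fun i => lp_norm p m (fun j => phi j (h i))) (fun i _ => s0 i)
  (fun i _ => powR_ge0 _ _) s1) _.
rewrite -(ler_powRp p1) ?powR_ge0// -powRrM mulVf ?gt_eqF// powR1 powRr1; last first.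
  by apply: sumr_ge0 => i _; exact: powR_ge0.
under eq_bigr do rewrite lp_norm_powR//.
exact: phi1.
Qed.

End bidual_mid.

(** * Sequence spaces *)

Section sequence_space_characterizations.
Context {R : realType}.

Lemma nneseries_leP (F : nat -> R) (c : R) : (forall n, 0 <= F n) ->
  (\sum_(n <oo) (F n)%:E <= c%:E)%E <-> forall N, \sum_(n < N) F n <= c.
Proof.
move=> F0; split=> [Fc N|Fc].
  rewrite -lee_fin -sumEFin -(big_mkord xpredT (fun n => (F n)%:E)).
  by apply: le_trans (nneseries_lim_ge N _) Fc => n _ _; rewrite lee_fin.
apply: lime_le; first by apply: is_cvg_nneseries => n _ _; rewrite lee_fin.
by apply: nearW => N; rewrite big_mkord sumEFin lee_fin.
Qed.

(** For each [N] the finite outer sum is moved inside the series in [j], where [nneseries_leP]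
    applies. *)
Lemma nneseries2_leP (F : nat -> nat -> R) (c : R) : (forall n j, 0 <= F n j) ->
  (\sum_(n <oo) \sum_(j <oo) (F n j)%:E <= c%:E)%E <->
  forall N m, \sum_(n < N) \sum_(j < m) F n j <= c.
Proof.
move=> F0; have F0' n j : (0 <= (F n j)%:E)%E by rewrite lee_fin.
have FN N : (\sum_(0 <= n < N) \sum_(j <oo) (F n j)%:E =
    \sum_(j <oo) (\sum_(n < N) F n j)%:E)%E.
  rewrite -nneseries_sum_nat//; apply: eq_eseriesr => j _.
  by rewrite big_mkord sumEFin.
have s0 N j : 0 <= \sum_(n < N) F n j by exact: sumr_ge0.
split=> [Fc N m|Fc].
  rewrite exchange_big /=; move: m; apply/(nneseries_leP _ (s0 N)); rewrite -FN.
  by apply: le_trans (nneseries_lim_ge N _) Fc => n _ _; exact: nneseries_ge0.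
apply: lime_le; first by apply: is_cvg_nneseries => n _ _; exact: nneseries_ge0.
apply: nearW => N; rewrite FN; apply/nneseries_leP => // m.
by rewrite exchange_big; exact: Fc.
Qed.

Lemma poweR_root_le (p : R) (S : \bar R) (c : R) : 0 < p -> (0 <= S)%E -> 0 <= c ->
  (S `^ p^-1 <= c%:E)%E <-> (S <= (c `^ p)%:E)%E.
Proof.
move=> p0 S0 c0; case: S S0 => [S|_|//]; last first.
  by rewrite poweRyr ?invr_neq0 ?gt_eqF// !leye_eq.
rewrite lee_fin => S0; rewrite poweR_EFin !lee_fin.
have cE : c = (c `^ p) `^ p^-1 by rewrite -powRrM mulfV ?gt_eqF// powRr1.
split=> Sc.
  have -> : S = (S `^ p^-1) `^ p by rewrite -powRrM mulVf ?gt_eqF// powRr1.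
  by apply: ge0_ler_powR; rewrite ?nnegrE ?powR_ge0// ltW.
by rewrite cE; apply: ge0_ler_powR; rewrite ?nnegrE ?powR_ge0// invr_ge0 ltW.
Qed.

Lemma lty_bound (x : \bar R) : (x < +oo)%E -> exists2 c : R, 0 < c & (x <= c%:E)%E.
Proof.
case: x => [x _|//|_]; last by exists 1; rewrite ?leNye.
by exists (`|x| + 1); rewrite ?ltr_wpDl// lee_fin (le_trans (ler_norm x))// lerDl.
Qed.

Lemma counting_eq0 (A : set nat) : counting A = 0%E :> \bar R -> A = set0.
Proof.
rewrite /counting; case: ifPn => [/asboolP finA|//] /eqP.
rewrite eqe pnatr_eq0 finmap.cardfs_eq0 => /eqP A0.
by apply/seteqP; split=> // x; rewrite -[A](fset_setK finA) A0.
Qed.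

(** Only the empty set is null for the counting measure, so the essential supremum is a supremum.
    [T0] selects the branch of [Lnorm] for spaces of positive measure. *)
Lemma Lnorm_counting_oo_le (F : nat -> R) (c : R) : (forall n, 0 <= F n) ->
  (Lnorm counting +oo (fun n => (F n)%:E) <= c%:E)%E <-> forall n, F n <= c.
Proof.
move=> F0; have T0 : (0 < counting [set: nat] :> \bar R)%E.
  rewrite lt_neqAle measure_ge0 andbT; apply/eqP => /esym/counting_eq0.
  by move=> /seteqP[/(_ 0%N I)].
rewrite unlock /Lnorm T0; split=> [/ess_supP[A [_ A0 FA]] n|Fc].
  rewrite leNgt; apply/negP => cF.
  have := FA n; rewrite (counting_eq0 A0); apply => /=.
  by rewrite lee_fin ger0_norm// leNgt cF.
by apply/ess_supP/nearW => n /=; rewrite lee_fin ger0_norm.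
Qed.

Context {k : base_field}.
Notation K := (scalars R k).
Variables (p : R) (p1 : 1 <= p).
Let p0 : 0 < p. Proof. exact: lt_le_trans p1. Qed.
Let r := 1 - p^-1.

Lemma ell_norm_leP (V : normedModType K) (z : V^nat) c : 0 <= c ->
  (ell_norm p%:E z <= c%:E)%E <-> forall N, \sum_(j < N) rnorm (z j) `^ p <= c `^ p.
Proof.
move=> c0; rewrite /ell_norm Lnorm_counting//.
under eq_eseriesr do rewrite /= ger0_norm ?rnorm_ge0//.
rewrite poweR_root_le//; last by apply: nneseries_ge0 => *; rewrite lee_fin powR_ge0.
by apply: nneseries_leP => j; exact: powR_ge0.
Qed.

(** For [p > 1] take [s j = (|z j| / c)^q], where [r q = 1]. For [p = 1] the exponent [r] is 0,
    every [s] gives the bound [c], and the zero sequence is a witness. *)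
Lemma ell_conj_norm_leP (V : normedModType K) (z : V^nat) c : 0 < c ->
  (ell_norm (hoelder_conjugate p%:E) z <= c%:E)%E <->
  exists2 s : nat -> R, (forall j, 0 <= s j) /\ (forall N, \sum_(j < N) s j <= 1) &
    forall j, rnorm (z j) <= c * s j `^ r.
Proof.
move=> c0; have [p_eq1|pn1] := eqVneq p 1.
  rewrite p_eq1 hoelder_conjugate1 /ell_norm Lnorm_counting_oo_le; last first.
    by move=> n; exact: rnorm_ge0.
  split=> [zc|[s _ zc] j]; last first.
    by apply: le_trans (zc j) _; rewrite /r p_eq1 invr1 subrr powRr0 mulr1.
  exists (fun=> 0); first by split=> // N; rewrite big1.
  by move=> j; rewrite /r p_eq1 invr1 subrr powRr0 mulr1.
have p_gt1 : 1 < p by rewrite lt_neqAle eq_sym pn1.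
have pB0 : p - 1 != 0 by rewrite subr_eq0.
pose q := p / (p - 1).
have q0 : 0 < q by rewrite divr_gt0// subr_gt0.
have -> : hoelder_conjugate p%:E = q%:E.
  by rewrite /hoelder_conjugate /= eqe gt_eqF// -EFinB inver (negPf pB0).
have rq : r * q = 1 by rewrite /r /q; field; rewrite pB0 gt_eqF.
have r0 : 0 < r by rewrite subr_gt0 invf_lt1.
rewrite /ell_norm Lnorm_counting//.
under eq_eseriesr do rewrite /= ger0_norm ?rnorm_ge0//.
rewrite poweR_root_le ?(ltW c0)//; last first.
  by apply: nneseries_ge0 => *; rewrite lee_fin powR_ge0.
rewrite nneseries_leP; last by move=> j; exact: powR_ge0.
have sE (x : R) : 0 <= x -> (x `^ r) `^ q = x by move=> x0; rewrite -powRrM rq powRr1.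
have sE' (x : R) : 0 <= x -> (x `^ q) `^ r = x.
  by move=> x0; rewrite -powRrM mulrC rq powRr1.
have cV : 0 <= c^-1 by rewrite invr_ge0 ltW.
split=> [zc|[s [s0 s1] zs] N].
  exists (fun j => (c^-1 * rnorm (z j)) `^ q).
    split=> [j|N]; first exact: powR_ge0.
    under eq_bigr do rewrite powRM ?rnorm_ge0//.
    rewrite -mulr_sumr -powR_inv1 ?(ltW c0)// -powRrM mulN1r powRN mulrC.
    by rewrite ler_pdivrMr ?powR_gt0// mul1r.
  move=> j; rewrite sE' ?mulr_ge0 ?rnorm_ge0// mulrA divff ?gt_eqF// mul1r//.
apply: (@le_trans _ _ (\sum_(j < N) c `^ q * s j)).
  apply: ler_sum => j _; rewrite -[in leRHS](sE (s j))// -powRM ?powR_ge0 ?(ltW c0)//.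
  by apply: ge0_ler_powR; rewrite ?(ltW q0) ?nnegrE ?rnorm_ge0 ?mulr_ge0 ?powR_ge0 ?(ltW c0).
by rewrite -mulr_sumr ger_pMr ?powR_gt0.
Qed.

Lemma ell_weak_norm_leP (V : normedModType K) (z : V^nat) c : 0 <= c ->
  (ell_weak_norm p z <= c%:E)%E <->
  forall f : dual V, rnorm f <= 1 -> forall N, \sum_(j < N) rnorm (f (z j)) `^ p <= c `^ p.
Proof.
move=> c0.
have E (f : dual V) : ((\sum_(j <oo) ((rnorm (f (z j))) `^ p)%:E) `^ p^-1 <= c%:E)%E <->
    forall N, \sum_(j < N) rnorm (f (z j)) `^ p <= c `^ p.
  rewrite poweR_root_le//; last by apply: nneseries_ge0 => *; rewrite lee_fin powR_ge0.
  by apply: nneseries_leP => j; exact: powR_ge0.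
split=> [zc f f1|zc].
  by apply/E; apply: le_trans zc; apply: ereal_sup_ubound; exists f.
by apply: ge_ereal_sup => _ [f f1 <-]; apply/E; exact: zc.
Qed.

Lemma ell_weak_ballP (V : normedModType K) (f : (dual V)^nat) :
  seq_ball (ell_weak p (dual V)) f <-> weak_bounded p f.
Proof.
rewrite (weak_boundedP p1); split=> [[_ /(ell_weak_norm_leP _ ler01)]|h].
  by rewrite powR1.
have fn : (ell_weak_norm p f <= 1%:E)%E.
  by apply/(ell_weak_norm_leP _ ler01); rewrite powR1; exact: h.
by split=> //=; apply: le_lt_trans fn (ltry _).
Qed.

Lemma ell_weak_scale (V : normedModType K) (f : (dual V)^nat) :
  ell_weak p (dual V) f ->
  exists2 a : R, 0 < a & weak_bounded p (fun n => to_scalars a *: f n).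
Proof.
move=> fy.
have [c c0 fc] := lty_bound fy.
exists c^-1; first by rewrite invr_gt0.
apply/(weak_boundedP p1) => th th1 N.
have /(ell_weak_norm_leP _ (ltW c0))/(_ th th1 N) h := fc.
under eq_bigr do rewrite dualZ rnormM rnorm_to_scalars ger0_norm ?invr_ge0 ?(ltW c0)//
  powRM ?invr_ge0 ?(ltW c0) ?rnorm_ge0//.
rewrite -mulr_sumr -powR_inv1 ?(ltW c0)// -powRrM mulN1r powRN mulrC.
by rewrite ler_pdivrMr ?powR_gt0// mul1r.
Qed.

Lemma mid_sum_leP (V : normedModType K) (z : V^nat) (f : (dual V)^nat) c : 0 <= c ->
  (mid_sum p z f `^ p^-1 <= c%:E)%E <->
  forall N m, \sum_(n < N) \sum_(j < m) rnorm (f n (z j)) `^ p <= c `^ p.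
Proof.
move=> c0; rewrite poweR_root_le//; last first.
  by apply: nneseries_ge0 => n _ _; apply: nneseries_ge0 => *; rewrite lee_fin powR_ge0.
by apply: nneseries2_leP => n j; exact: powR_ge0.
Qed.

Lemma ell_mid_norm_leP (V : normedModType K) (z : V^nat) c : 0 <= c ->
  (seq_norm (ell_mid p V) z <= c%:E)%E <-> forall m, mid_bounded p m z c.
Proof.
move=> c0; split=> [zc m f /ell_weak_ballP fw N|zc].
  move: m; apply: (proj1 (mid_sum_leP z f c0) _ N).
  by apply: le_trans zc; apply: ereal_sup_ubound; exists f.
apply: ge_ereal_sup => _ [f /ell_weak_ballP fw <-].
by apply/(mid_sum_leP z f c0) => N m; exact: zc.
Qed.

End sequence_space_characterizations.

(** * Finiteness of the mid norm *)

Section gliding_hump.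
Context {R : realType} {k : base_field}.
Notation K := (scalars R k).
Variables (p : R) (p1 : 1 <= p).
Let p0 : 0 < p. Proof. exact: lt_le_trans p1. Qed.

(** Both sides bound the sum over all pairs, which does not depend on the order because the terms
    are nonnegative. *)
Lemma sum_pairs_le (G : nat -> nat -> R) (e : nat -> nat * nat) (c : R) :
  (forall i j, 0 <= G i j) -> set_bij [set: nat] [set: nat * nat] e ->
  (forall N, \sum_(i < N) G (e i).1 (e i).2 <= c) <->
  (forall N m, \sum_(i < N) \sum_(j < m) G i j <= c).
Proof.
move=> G0 ebij; rewrite -(@nneseries2_leP R G c G0).
rewrite -(@nneseries_leP R (fun i => G (e i).1 (e i).2) c (fun i => G0 _ _)).
suff -> : (\sum_(n <oo) (G (e n).1 (e n).2)%:E = \sum_(n <oo) \sum_(j <oo) (G n j)%:E)%E.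
  by [].
have G0' i j : (0 <= (G i j)%:E)%E by rewrite lee_fin.
rewrite nneseries_esumT// nneseries_esumT; last by move=> n; exact: nneseries_ge0.
under [RHS]eq_esum do rewrite nneseries_esumT//.
rewrite esum_esum//.
rewrite (reindex_esum [set: nat] _ e (fun x : nat * nat => (G x.1 x.2)%:E))//.
rewrite (_ : _ `*`` _ = [set: nat * nat])//.
by apply/seteqP; split.
Qed.

Lemma mid_bounded_scale (V : normedModType K) m (x : nat -> V) a c : 0 < a -> 0 <= c ->
  mid_bounded p m x c -> mid_bounded p m (fun j => to_scalars a *: x j) (a * c).
Proof.
move=> a0 c0 xc f fw N; rewrite powRM ?(ltW a0)//.
apply: le_trans (ler_wpM2l (powR_ge0 _ _) (xc f fw N)).
rewrite mulr_sumr; apply: ler_sum => n _; rewrite mulr_sumr; apply: ler_sum => j _.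
by rewrite dualZ rnormM rnorm_to_scalars gtr0_norm// powRM ?(ltW a0) ?rnorm_ge0.
Qed.

Lemma ell_mid_of_norm (V : normedModType K) (z : V^nat) c : 0 <= c ->
  (seq_norm (ell_mid p V) z <= c%:E)%E -> ell_mid p V z.
Proof.
move=> c0 /(ell_mid_norm_leP p1 _ c0) zc f /(ell_weak_scale p1)[a a0 fw].
suff : (mid_sum p z f <= ((c / a) `^ p)%:E)%E by move=> /le_lt_trans; apply; exact: ltry.
apply/nneseries2_leP => [n j|N m]; first exact: powR_ge0.
rewrite -(ler_pM2l (powR_gt0 p a0)) -powRM ?divr_ge0 ?(ltW a0)//.
rewrite [a * _]mulrC mulfVK ?gt_eqF//; apply: le_trans (zc m _ fw N).
rewrite mulr_sumr; apply: ler_sum => n _; rewrite mulr_sumr; apply: ler_sum => j _.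
have -> : (to_scalars a *: f n : dual V) (z j) = to_scalars a * f n (z j) by [].
by rewrite rnormM rnorm_to_scalars gtr0_norm// powRM ?(ltW a0) ?rnorm_ge0.
Qed.

(* If the norm were infinite, weakly bounded sequences [f k] with mid sums above
   [4 ^ k], weighted by [2 ^ - (k + 1)] and merged into a single sequence, would
   give an infinite mid sum. *)
Lemma ell_mid_norm_bound (V : normedModType K) (z : V^nat) : ell_mid p V z ->
  exists2 c, 0 < c & (seq_norm (ell_mid p V) z <= c%:E)%E.
Proof.
move=> zmid; apply: contrapT => nobound.
have /boolp.choice[f fP] (i : nat) : exists f : nat -> dual V, weak_bounded p f /\
    exists N m, 4 ^+ i < \sum_(n < N) \sum_(j < m) rnorm (f n (z j)) `^ p.
  apply: contrapT => nof; apply: nobound; exists ((4 ^+ i) `^ p^-1).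
    by rewrite powR_gt0// exprn_gt0.
  apply/(ell_mid_norm_leP p1); first exact: powR_ge0.
  move=> m f fw N; rewrite -powRrM mulVf ?gt_eqF// powRr1 ?exprn_ge0//.
  by rewrite leNgt; apply/negP => h; apply: nof; exists f; split=> //; exists N, m.
have /card_set_bijP[e ebij] : ([set: nat] #= [set: nat * nat])%card.
  by rewrite card_eq_sym card_nat2.
pose a i : R := 2^-1 ^+ i.+1.
have a0 i : 0 < a i by rewrite exprn_gt0// invr_gt0.
have suma N : \sum_(i < N) a i <= 1.
  suff -> : \sum_(i < N) a i = 1 - 2^-1 ^+ N by rewrite gerBl exprn_ge0// invr_ge0.
  elim: N => [|N IH]; first by rewrite big_ord0 expr0 subrr.
  by rewrite big_ord_recr/= IH /a exprS; field.
(* The root [1/p] makes the weight of the p-th powers equal to [a]. *)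
pose F i : dual V := to_scalars (a (e i).1 `^ p^-1) *: f (e i).1 (e i).2.
have FE i v : rnorm (F i v) `^ p = a (e i).1 * rnorm (f (e i).1 (e i).2 v) `^ p.
  have -> : F i v = to_scalars (a (e i).1 `^ p^-1) * f (e i).1 (e i).2 v by [].
  rewrite rnormM rnorm_to_scalars ger0_norm ?powR_ge0// powRM ?powR_ge0 ?rnorm_ge0//.
  by rewrite -powRrM mulVf ?gt_eqF// powRr1// ltW.
have Fw : weak_bounded p F.
  move=> v; under eq_forall => N do under eq_bigr do rewrite FE.
  apply/(sum_pairs_le (G := fun i n => a i * rnorm (f i n v) `^ p) _ _ ebij).
    by move=> i j; rewrite mulr_ge0 ?powR_ge0// ltW.
  move=> N m; apply: (@le_trans _ _ (\sum_(i < N) a i * rnorm v `^ p)).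
    apply: ler_sum => i _; rewrite -mulr_sumr ler_wpM2l ?(ltW (a0 i))//.
    exact: (fP i).1.
  by rewrite -mulr_suml ler_piMl ?powR_ge0.
have [c c0 Fc] := lty_bound (zmid F (proj1 (iffRL (ell_weak_ballP p1 F) Fw))).
move/nneseries2_leP : Fc => /(_ (fun n j => powR_ge0 _ _)) Fc.
(* The terms of [f i] alone contribute this much to the mid sum of [F]. *)
have {}Fc i : 4 ^+ i * a i <= c.
  have [N [m fi]] := (fP i).2.
  apply: (@le_trans _ _ (a i * \sum_(n < N) \sum_(j < m) rnorm (f i n (z j)) `^ p)).
    by rewrite mulrC ler_wpM2l ?(ltW (a0 i))// ltW.
  pose G i n := a i * \sum_(j < m) rnorm (f i n (z j)) `^ p.
  have G0 i' n : 0 <= G i' n.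
    by rewrite mulr_ge0 ?(ltW (a0 _))// sumr_ge0// => j _; exact: powR_ge0.
  have Gc : forall N, \sum_(i < N) G (e i).1 (e i).2 <= c.
    move=> N'; apply: le_trans (Fc N' m); apply: ler_sum => i' _.
    by rewrite /G mulr_sumr; apply: ler_sum => j _; rewrite FE.
  have := proj1 (sum_pairs_le c G0 ebij) Gc i.+1 N.
  rewrite big_ord_recr /= mulr_sumr; apply: le_trans; rewrite lerDr.
  by apply: sumr_ge0 => i' _; exact: sumr_ge0.
(* Here [2 c < i < 2^i], while [4^i a i = 2^i / 2]. *)
pose i := (Num.truncn (2 * c)).+1.
have := Fc i; apply/negP; rewrite -ltNge.
have -> : 4 ^+ i * a i = 2 ^+ i / 2.
  by rewrite /a exprSr mulrA -exprMn; congr (_ ^+ _ * _); field.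
rewrite ltr_pdivlMr// mulrC; apply: lt_trans (truncnS_gt _) _.
by rewrite -/i -natrX ltr_nat ltn_expl.
Qed.

End gliding_hump.

(** * Continuity and boundedness of induced maps *)

Section induced_maps.
Context {R : realType} {k : base_field}.
Notation K := (scalars R k).

Definition homogeneous (V : normedModType K) (S : seq_space V) :=
  forall (z : V^nat) a c, 0 < a -> 0 < c -> (seq_norm S z <= c%:E)%E ->
  (seq_norm S (fun j => to_scalars a *: z j) <= (a * c)%:E)%E.

Definition finite_norm_space (V : normedModType K) (S : seq_space V) :=
  forall z : V^nat, S z <-> exists2 c, 0 < c & (seq_norm S z <= c%:E)%E.

Lemma induced_norm_leP (U V : normedModType K) (S : seq_space U) (S' : seq_space V)
    (T : {linear U -> V}) (B : \bar R) :
  (induced_norm S S' T <= B)%E <->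
  forall z, seq_ball S z -> (seq_norm S' (induced_seq T z) <= B)%E.
Proof.
split=> [h z zS|h]; last by apply: ge_ereal_sup => _ [z zS <-]; exact: h.
by apply: le_trans h; apply: ereal_sup_ubound; exists z.
Qed.

(** Of the target only the passage from a finite norm to membership is required. The converse, which
    [ell_mid] owes to the gliding hump, is required of the source. *)
Lemma induced_bounded (U V : normedModType K) (S : seq_space U) (S' : seq_space V)
    (T : {linear U -> V}) :
  homogeneous S -> homogeneous S' -> finite_norm_space S ->
  (forall z c, 0 < c -> (seq_norm S' z <= c%:E)%E -> S' z) ->
  S 0 ->
  induced_well_defined S S' T /\ induced_continuous S S' T <->
  exists2 B, 0 < B & (induced_norm S S' T <= B%:E)%E.
Proof.
move=> hS hS' fS fS' S0.
have indZ a (z : U^nat) : induced_seq T (fun j => to_scalars a *: z j) =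
    (fun j => to_scalars a *: induced_seq T z j).
  by apply/funext => j; rewrite /induced_seq linearZ.
have scaleK (W : normedModType K) a (z : W^nat) : 0 < a ->
    (fun j => to_scalars a *: (fun i => to_scalars a^-1 *: z i) j) = z.
  move=> a0; apply/funext => j.
  by rewrite scalerA -to_scalarsM divff ?gt_eqF// to_scalars1 scale1r.
(* Continuity is used at 0 with [e = 1]: scaling by [d / 2] takes the unit ball into the ball of
   radius [d]. *)
split=> [[wd /(_ 0 S0 1 ltr01)[d d0 dT]]|[B B0 /induced_norm_leP TB]].
  have d2 : 0 < d / 2 by rewrite divr_gt0.
  exists (2 / d); first by rewrite divr_gt0.
  apply/induced_norm_leP => z [zS z1].
  pose y : U^nat := fun j => to_scalars (d / 2) *: z j.
  have yd : (seq_norm S y <= (d / 2)%:E)%E.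
    by have := hS z (d / 2) 1 d2 ltr01 z1; rewrite mulr1.
  have yS : S y by apply/fS; exists (d / 2).
  have := dT y yS; rewrite subr0 => /(_ (le_lt_trans yd _)).
  rewrite lte_fin => /(_ _)/wrap[]; first by rewrite ltr_pdivrMr// ltr_pMr// ltr1n.
  have -> : induced_seq T y - induced_seq T 0 = induced_seq T y.
    by apply/funext => j; rewrite /induced_seq /= !fctE linear0 subr0.
  move=> /ltW Ty; have := hS' _ (2 / d) 1 _ ltr01 Ty.
  rewrite mulr1 divr_gt0// => /(_ isT); rewrite indZ.
  rewrite (_ : (fun j => _) = induced_seq T z)//; apply/funext => j.
  rewrite scalerA -to_scalarsM (_ : 2 / d * (d / 2) = 1) ?to_scalars1 ?scale1r//.
  by field; rewrite gt_eqF.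
have bound z c : 0 < c -> (seq_norm S z <= c%:E)%E ->
    (seq_norm S' (induced_seq T z) <= (c * B)%:E)%E.
  move=> c0 zc; have cV : 0 < c^-1 by rewrite invr_gt0.
  have y1 : (seq_norm S (fun j => to_scalars c^-1 *: z j) <= 1%:E)%E.
    by have := hS z c^-1 c cV c0 zc; rewrite mulVf ?gt_eqF.
  have yS : S (fun j => to_scalars c^-1 *: z j) by apply/fS; exists 1.
  have := hS' _ c B c0 B0 (TB _ (conj yS y1)).
  by rewrite indZ scaleK.
split=> [z /fS[c c0 zc]|z zS e e0].
  by apply: (fS' _ (c * B)); [exact: mulr_gt0|exact: bound].
(* The factor 2 turns the weak inequality of [bound] into a strict one. *)
exists (e / (2 * B)); first by rewrite divr_gt0// mulr_gt0.
move=> z' z'S /ltW zz'.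
have -> : induced_seq T z' - induced_seq T z = induced_seq T (z' - z).
  by apply/funext => j; rewrite /induced_seq /= !fctE linearB.
apply: le_lt_trans (bound _ _ _ zz') _; first by rewrite divr_gt0// mulr_gt0.
rewrite lte_fin (_ : e / (2 * B) * B = e / 2); last by field; rewrite gt_eqF.
by rewrite ltr_pdivrMr// ltr_pMr// ltr1n.
Qed.

Variables (p : R) (p1 : 1 <= p).
Let p0 : 0 < p. Proof. exact: lt_le_trans p1. Qed.

Lemma ell_homogeneous (V : normedModType K) : homogeneous (ell p%:E V).
Proof.
move=> z a c a0 c0 /(ell_norm_leP p1 _ (ltW c0)) zc.
apply/(ell_norm_leP p1); first by rewrite mulr_ge0// ltW.
move=> N; under eq_bigr do rewrite rnormZ rnorm_to_scalars gtr0_norm//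
  powRM ?(ltW a0) ?rnorm_ge0//.
by rewrite -mulr_sumr powRM ?(ltW a0) ?(ltW c0)// ler_wpM2l ?powR_ge0.
Qed.

Lemma ell_conj_homogeneous (V : normedModType K) :
  homogeneous (ell (hoelder_conjugate p%:E) V).
Proof.
move=> z a c a0 c0 /(ell_conj_norm_leP p1 _ c0)[s sP zs].
apply/(ell_conj_norm_leP p1 _ (mulr_gt0 a0 c0)); exists s => // j.
by rewrite rnormZ rnorm_to_scalars gtr0_norm// -mulrA ler_pM2l.
Qed.

Lemma ell_finite_norm (q : \bar R) (V : normedModType K) : finite_norm_space (ell q V).
Proof.
by move=> z; split=> [/lty_bound//|[c _ zc]]; exact: le_lt_trans zc (ltry _).
Qed.

Lemma ell_mid_homogeneous (V : normedModType K) : homogeneous (ell_mid p V).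
Proof.
move=> z a c a0 c0 /(ell_mid_norm_leP p1 _ (ltW c0)) zc.
apply/(ell_mid_norm_leP p1); first by rewrite mulr_ge0// ltW.
by move=> m; apply: mid_bounded_scale => //; exact: ltW.
Qed.

Lemma ell_mid_finite_norm (V : normedModType K) : finite_norm_space (ell_mid p V).
Proof.
move=> z; split=> [/(ell_mid_norm_bound p1)//|[c c0 zc]].
exact: (ell_mid_of_norm p1 (ltW c0) zc).
Qed.

Lemma ell_mid_ballP (V : normedModType K) (z : V^nat) :
  seq_ball (ell_mid p V) z <-> forall m, mid_bounded p m z 1.
Proof.
split=> [[_ /(ell_mid_norm_leP p1 _ ler01)]//|/(ell_mid_norm_leP p1 _ ler01) z1].
by split=> //; exact: (ell_mid_of_norm p1 ler01 z1).
Qed.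

Lemma ell_mid_dual_norm_leP (V : normedModType K) (z : V^nat) c : 0 <= c ->
  (seq_norm (ell_mid_dual p V) z <= c%:E)%E <->
  forall f : (dual V)^nat, (forall m, mid_bounded p m f 1) ->
  forall m, \sum_(j < m) rnorm (f j (z j)) <= c.
Proof.
move=> c0.
have E (f : (dual V)^nat) : (pairing_sum z f <= c%:E)%E <->
    forall m, \sum_(j < m) rnorm (f j (z j)) <= c.
  by apply: nneseries_leP => j; exact: rnorm_ge0.
split=> [zc f /ell_mid_ballP fb|zc].
  by apply/E; apply: le_trans zc; apply: ereal_sup_ubound; exists f.
by apply: ge_ereal_sup => _ [f /ell_mid_ballP fb <-]; apply/E; exact: zc.
Qed.

Lemma ell_mid_dual_homogeneous (V : normedModType K) : homogeneous (ell_mid_dual p V).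
Proof.
move=> z a c a0 c0 /(ell_mid_dual_norm_leP _ (ltW c0)) zc.
apply/ell_mid_dual_norm_leP; first by rewrite mulr_ge0// ltW.
move=> f fb m; under eq_bigr do rewrite dualZ rnormM rnorm_to_scalars gtr0_norm//.
by rewrite -mulr_sumr ler_pM2l//; exact: zc.
Qed.

(** Any [f] in [ell_mid] has finite norm by [ell_mid_norm_bound] and can be scaled into the unit
    ball. *)
Lemma ell_mid_dual_of_norm (V : normedModType K) (z : V^nat) c : 0 < c ->
  (seq_norm (ell_mid_dual p V) z <= c%:E)%E -> ell_mid_dual p V z.
Proof.
move=> c0 /(ell_mid_dual_norm_leP _ (ltW c0)) zc f /(ell_mid_norm_bound p1)[b b0 fb].
have bV : 0 < b^-1 by rewrite invr_gt0.
suff : (pairing_sum z f <= (b * c)%:E)%E by move=> /le_lt_trans; apply; exact: ltry.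
apply/nneseries_leP => [j|m]; first exact: rnorm_ge0.
rewrite -ler_pdivrMl// mulr_sumr; apply: le_trans (zc (fun j => to_scalars b^-1 *: f j) _ m).
  apply: ler_sum => j _.
  have -> : (to_scalars b^-1 *: f j : dual V) (z j) = to_scalars b^-1 * f j (z j) by [].
  by rewrite rnormM rnorm_to_scalars gtr0_norm.
have := @ell_mid_homogeneous (dual V) f b^-1 b bV b0 fb.
by rewrite mulVf ?gt_eqF// => /(ell_mid_norm_leP p1 _ ler01).
Qed.

End induced_maps.

(** * Duality *)

Section duality.
Context {R : realType} {k : base_field}.
Notation K := (scalars R k).
Notation re := (@scalars_re R k).
Variables (p : R) (p1 : 1 <= p).
Let p0 : 0 < p. Proof. exact: lt_le_trans p1. Qed.
Let r := 1 - p^-1.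
Notation q := (hoelder_conjugate p%:E).

(** The converse of Hoelder's inequality, tested on the extremal weights, which are extended by 0
    beyond [m]. *)
Lemma lp_sum_le (b : nat -> R) C m : 0 <= C -> (forall j, 0 <= b j) ->
  (forall s : nat -> R, (forall j, 0 <= s j) -> (forall N, \sum_(j < N) s j <= 1) ->
     \sum_(j < m) s j `^ r * b j <= C) ->
  \sum_(j < m) b j `^ p <= C `^ p.
Proof.
move=> C0 b0 bC.
have [s [s0 s1] sE] := @hoelder_extremal R p p1 _ (index_enum 'I_m)
  (fun j => b j) (fun j => b0 j).
pose s' j : R := if insub j is Some j' then s (j' : 'I_m) else 0.
have s'E (j : 'I_m) : s' j = s j by rewrite /s' valK.
have s'0 j : 0 <= s' j by rewrite /s'; case: insub.
have bp0 : 0 <= \sum_(j < m) b j `^ p by apply: sumr_ge0 => j _; exact: powR_ge0.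
have -> : \sum_(j < m) b j `^ p = ((\sum_(j < m) b j `^ p) `^ p^-1) `^ p.
  by rewrite -powRrM mulVf ?gt_eqF// powRr1.
rewrite (ler_powRp p1) ?powR_ge0// -sE.
under eq_bigr do rewrite -s'E; apply: bC => // N.
apply: le_trans s1; under [leRHS]eq_bigr do rewrite -s'E.
rewrite -!(big_mkord xpredT s').
have [Nm|/ltnW mN] := leqP N m.
  rewrite (big_cat_nat (leq0n N) Nm)//= lerDl; exact: sumr_ge0.
rewrite (big_cat_nat (leq0n m) mN)//= gerDl big_nat_cond big1// => j /andP[/andP[mj _] _].
by rewrite /s' insubF// ltnNge mj.
Qed.

(** Norms that may be infinite are compared through real bounds: [+oo] has none, and a finite
    nonnegative value is the infimum of the positive reals above it. *)
Lemma eq_ereal_by_bounds (A B : \bar R) : (0 <= A)%E -> (0 <= B)%E ->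
  (forall C, 0 < C -> (A <= C%:E)%E <-> (B <= C%:E)%E) -> A = B.
Proof.
have le_by (A' B' : \bar R) : (0 <= B')%E ->
    (forall C, 0 < C -> (B' <= C%:E)%E -> (A' <= C%:E)%E) -> (A' <= B')%E.
  move=> B0 h; case: B' B0 h => [b|_ _|+ _]; [|by rewrite leey|by rewrite leeNy_eq].
  rewrite lee_fin => b0 h; apply/lee_addgt0Pr => e e0.
  by rewrite -EFinD; apply: h; rewrite ?ltr_wpDl// lee_fin lerDl ltW.
move=> A0 B0 AB; apply/eqP; rewrite eq_le; apply/andP; split; apply: le_by => // C C0 h.
  exact: (AB C C0).2.
exact: (AB C C0).1.
Qed.

Lemma evaluation_adjoint_subproof (V : normedModType K) (f : dual (dual (dual V))) :
  (fun v : V => f (evaluation v)) \in dual_pred V.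
Proof.
apply: (@dual_pred_bounded _ _ _ _ (rnorm f)) => [a u v|v].
  have -> : evaluation (a *: u + v) = a *: evaluation u + evaluation v.
    by apply/val_inj/funext => g /=; rewrite linearP.
  exact: linearP.
rewrite rnorm_dual; apply: le_trans (dual_norm_ub _ _) _.
by rewrite ler_wpM2l ?dual_norm_ge0// rnorm_evaluation.
Qed.

(** Functionals on the bidual are restricted to [V] along the canonical embedding, which does not
    increase norms, so weak boundedness is kept. *)
Lemma mid_bounded_evaluation (V : normedModType K) m (x : nat -> V) c :
  mid_bounded p m x c -> mid_bounded p m (fun j => evaluation (x j)) c.
Proof.
move=> xc f fw N.
apply: (xc (fun n => Dual (evaluation_adjoint_subproof (f n))) _ N) => v M.
apply: le_trans (fw (evaluation v) M) _.
by rewrite (ler_powRp p1) ?rnorm_ge0// rnorm_evaluation.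
Qed.

(** The [phi j] are tested on the images of the [h n] in the third dual, weakly bounded by
    [weak_bounded_bidual]. *)
Lemma mid_bounded_bidual (V : normedModType K) m (phi : nat -> dual (dual V)) h :
  mid_bounded p m phi 1 -> weak_bounded p h ->
  forall N, \sum_(n < N) \sum_(j < m) rnorm (phi j (h n)) `^ p <= 1.
Proof.
move=> phi1 hw N; have := phi1 (fun n => evaluation (h n)) _ N; rewrite powR1; apply.
by move=> th M; exact: weak_bounded_bidual.
Qed.

Lemma almost_norming (V : normedModType K) (f : dual V) e : 0 < e ->
  exists2 v, rnorm v <= 1 & rnorm f - e <= rnorm (f v).
Proof.
move=> e0; apply: contrapT => no.
suff : rnorm f <= rnorm f - e by rewrite leNgt gtrBl e0.
rewrite {1}rnorm_dual; apply: dual_norm_le => v v1.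
by rewrite leNgt; apply/negP => h; apply: no; exists v => //; exact: ltW.
Qed.

Variables (X Y : normedModType K) (T : {linear X -> Y}) (cT : continuous T).
Notation Tstar := (adjoint cT : {linear dual Y -> dual X}).

Lemma ell_conj_ball (V : normedModType K) (s : nat -> R) (v : nat -> V) :
  (forall j, 0 <= s j) -> (forall N, \sum_(j < N) s j <= 1) ->
  (forall j, rnorm (v j) <= 1) ->
  seq_ball (ell q V) (fun j => to_scalars (s j `^ r) *: v j).
Proof.
move=> s0 s1 v1.
have n1 : (ell_norm q (fun j => to_scalars (s j `^ r) *: v j) <= 1%:E)%E.
  apply/(ell_conj_norm_leP p1 _ ltr01); exists s => // j.
  by rewrite rnormZ rnorm_to_scalars ger0_norm ?powR_ge0// mul1r ler_piMr ?powR_ge0.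
by split=> //; exact: le_lt_trans n1 (ltry _).
Qed.

Lemma adjoint_induced_le C : 0 < C ->
  (mid_summing_norm p T <= C%:E)%E ->
  (induced_norm (ell q (dual Y)) (ell_mid_dual p (dual X)) Tstar <= C%:E)%E.
Proof.
move=> C0 /induced_norm_leP TC; apply/induced_norm_leP => F [_ F1].
have [s [s0 s1] Fs] := (ell_conj_norm_leP p1 F ltr01).1 F1.
apply/(ell_mid_dual_norm_leP p1 _ (ltW C0)) => phi phi1 m.
(* The phases are absorbed into the functionals, which makes the sum of moduli a real part as in
   [mid_bidual]. *)
have /boolp.choice[u uP] (j : nat) : exists u : K, rnorm (u : K^o) = 1 /\
    u * phi j (Tstar (F j)) = to_scalars (rnorm (phi j (Tstar (F j)))).
  by have [u ? ?] := phase (phi j (Tstar (F j))); exists u.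
have -> : \sum_(j < m) rnorm (phi j (induced_seq Tstar F j)) =
    re (\sum_(j < m) phi j (u j *: Tstar (F j))).
  rewrite scalars_re_sum; apply: eq_bigr => j _.
  by rewrite dualZ (uP j).2 to_scalarsK.
apply: (mid_bidual p1 C0 (g := fun j => u j *: Tstar (F j))); last first.
  by move=> h hw N; apply: mid_bounded_bidual.
have pos x c : 0 < c -> mid_bounded p m x c ->
    re (\sum_(j < m) (u j *: Tstar (F j) : dual X) (x j)) <= C * c.
  (* Cut off after [m] terms and divided by [c], the tuple becomes a sequence in the mid unit ball,
     to which the bound on [T] applies. *)
  move=> c0 xc; pose x' j := if (j < m)%N then to_scalars c^-1 *: x j else 0.
  have x'1 : seq_ball (ell_mid p X) x'.
    apply/(ell_mid_ballP p1) => m' f fw N.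
    have cV : 0 < c^-1 by rewrite invr_gt0.
    have := mid_bounded_scale cV (ltW c0) xc fw N; rewrite mulVf ?gt_eqF//.
    apply: le_trans; apply: ler_sum => n _.
    pose G j := rnorm (f n (x' j)) `^ p.
    rewrite [leRHS](eq_bigr (fun j : 'I_m => G j)); last first.
      by move=> j _; rewrite /G /x' ltn_ord.
    have G0 j : 0 <= G j by exact: powR_ge0.
    rewrite -!(big_mkord xpredT G).
    have [m'm|/ltnW mm'] := leqP m' m.
      rewrite (big_cat_nat (leq0n m') m'm)//= lerDl; exact: sumr_ge0.
    rewrite (big_cat_nat (leq0n m) mm')//= gerDl big_nat_cond big1// => j /andP[/andP[mj _] _].
    by rewrite /G /x' ltnNge mj/= linear0 rnorm0 powR0 ?gt_eqF.
  have /(ell_norm_leP p1 _ (ltW C0))/(_ m) Tx' := TC _ x'1.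
  apply: le_trans (scalars_re_le_rnorm _) _.
  apply: le_trans (@rnorm_sum R k K^o _ _ _ _) _.
  apply: (@le_trans _ _ (\sum_(j < m) c * (s j `^ r * rnorm (T (x' j))))).
    apply: ler_sum => j _.
    have -> : (u j *: Tstar (F j) : dual X) (x j) = u j * F j (T (x j)) by [].
    rewrite rnormM (uP j).1 mul1r; apply: le_trans (dual_norm_ub _ _) _.
    rewrite /x' ltn_ord linearZ rnormZ rnorm_to_scalars gtr0_norm ?invr_gt0//.
    rewrite mulrCA mulVKf ?gt_eqF// ler_wpM2r ?rnorm_ge0// -rnorm_dual.
    by apply: le_trans (Fs j) _; rewrite mul1r.
  rewrite -mulr_sumr mulrC ler_wpM2r ?(ltW c0)//.
  apply: le_trans (@sum_hoelder1 R p p1 _ (index_enum 'I_m) xpredT (fun j => s j)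
    (fun j => rnorm (T (x' j))) (fun j _ => s0 j) (fun j _ => rnorm_ge0 _) (s1 m)) _.
  rewrite -(ler_powRp p1) ?powR_ge0 ?(ltW C0)// -powRrM mulVf ?gt_eqF// powRr1//.
  by apply: sumr_ge0 => j _; exact: powR_ge0.
(* A tuple with mid bound 0 has every positive bound [e / C], so the case [c = 0] is a limit of the
   previous one. *)
move=> x c; rewrite le_eqVlt => /orP[/eqP <-|]; last exact: pos.
move=> x0; apply/ler_addgt0Pr => e e0; rewrite mulr0 add0r.
have eC : 0 < e / C by rewrite divr_gt0.
have -> : e = C * (e / C) by rewrite mulrCA divff ?gt_eqF// mulr1.
apply: pos => // f fw N; apply: le_trans (x0 f fw N) _.
by rewrite powR0 ?gt_eqF ?powR_ge0.
Qed.

(** Functionals norming the [T (x j)], weighted by [s j ^ r], form an element of the unit ball of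
    [ell q]; its image is tested on the evaluations at the [x j]. [lp_sum_le] then removes the
    weights. *)
Lemma mid_summing_le_adjoint C : 0 < C ->
  (induced_norm (ell q (dual Y)) (ell_mid_dual p (dual X)) Tstar <= C%:E)%E ->
  (mid_summing_norm p T <= C%:E)%E.
Proof.
move=> C0 /induced_norm_leP TC; apply/induced_norm_leP => x /(ell_mid_ballP p1) x1.
apply/(ell_norm_leP p1 _ (ltW C0)) => m.
apply: lp_sum_le (ltW C0) (fun j => rnorm_ge0 _) _ => s s0 s1.
have /boolp.choice[f fP] (j : nat) : exists f : dual Y, rnorm f <= 1 /\
    re (f (T (x j))) = rnorm (T (x j)).
  have [f f1 fE] := norming_functional (T (x j)); exists f; split=> //.
  by apply/rnorm_dual_le => // v; rewrite mul1r.
have F1 := ell_conj_ball s0 s1 (fun j => (fP j).1).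
have := (ell_mid_dual_norm_leP p1 _ (ltW C0)).1 (TC _ F1)
  (fun j => evaluation (x j)) (fun m => mid_bounded_evaluation (x1 m)) m.
apply: le_trans; apply: ler_sum => j _.
have -> : evaluation (x j) (induced_seq Tstar
   (fun j => to_scalars (s j `^ r) *: f j) j) = to_scalars (s j `^ r) * f j (T (x j)) by [].
rewrite rnormM rnorm_to_scalars ger0_norm ?powR_ge0// ler_wpM2l ?powR_ge0//.
by rewrite -(fP j).2 scalars_re_le_rnorm.
Qed.

(** The test sequence [f] already lies in the source of the map induced by [Tstar], so Hoelder's
    inequality suffices. *)
Lemma induced_le_adjoint_mid C : 0 < C ->
  (mid_summing_norm p Tstar <= C%:E)%E ->
  (induced_norm (ell q X) (ell_mid_dual p Y) T <= C%:E)%E.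
Proof.
move=> C0 /induced_norm_leP TC; apply/induced_norm_leP => x [_ x1].
have [s [s0 s1] xs] := (ell_conj_norm_leP p1 x ltr01).1 x1.
apply/(ell_mid_dual_norm_leP p1 _ (ltW C0)) => f /(ell_mid_ballP p1) f1 m.
have /(ell_norm_leP p1 _ (ltW C0))/(_ m) Tf := TC _ f1.
apply: (@le_trans _ _ (\sum_(j < m) s j `^ r * rnorm (Tstar (f j)))).
  apply: ler_sum => j _; rewrite mulrC.
  apply: le_trans (dual_norm_ub (Tstar (f j)) (x j)) _.
  rewrite -rnorm_dual ler_wpM2l ?rnorm_ge0//.
  by apply: le_trans (xs j) _; rewrite mul1r.
apply: le_trans (@sum_hoelder1 R p p1 _ (index_enum 'I_m) xpredT (fun j => s j)
  (fun j => rnorm (Tstar (f j))) (fun j _ => s0 j) (fun j _ => rnorm_ge0 _) (s1 m)) _.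
rewrite -(ler_powRp p1) ?powR_ge0 ?(ltW C0)// -powRrM mulVf ?gt_eqF// powRr1//.
by apply: sumr_ge0 => j _; exact: powR_ge0.
Qed.

(** The functionals [Tstar (f j)] need not attain their norms, so they are tested on almost norming
    vectors weighted by [s j ^ r]. *)
Lemma adjoint_mid_le_induced C : 0 < C ->
  (induced_norm (ell q X) (ell_mid_dual p Y) T <= C%:E)%E ->
  (mid_summing_norm p Tstar <= C%:E)%E.
Proof.
move=> C0 /induced_norm_leP TC; apply/induced_norm_leP => f /(ell_mid_ballP p1) f1.
apply/(ell_norm_leP p1 _ (ltW C0)) => m.
apply: lp_sum_le (ltW C0) (fun j => rnorm_ge0 _) _ => s s0 s1.
apply/ler_addgt0Pr => e e0.
(* There are [m] errors, with weights at most 1, so they add up to at most [e]; the successor covers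
   [m = 0]. *)
have e'0 : 0 < e / m.+1%:R by rewrite divr_gt0// ltr0n.
have /boolp.choice[x xP] (j : nat) : exists x : X, rnorm x <= 1 /\
    rnorm (Tstar (f j)) - e / m.+1%:R <= rnorm (Tstar (f j) x).
  by have [x ? ?] := almost_norming (Tstar (f j)) e'0; exists x.
have x1 := ell_conj_ball s0 s1 (fun j => (xP j).1).
have h := (ell_mid_dual_norm_leP p1 _ (ltW C0)).1 (TC _ x1) f f1 m.
have sr (j : 'I_m) : s j `^ r <= 1.
  rewrite -[leRHS](_ : 1 `^ r = 1); last by rewrite powR1.
  apply: ge0_ler_powR; rewrite ?nnegrE//; first by have /andP[] := conj_exp_itv p1.
  apply: le_trans (s1 j.+1); rewrite big_ord_recr/= lerDr; exact: sumr_ge0.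
apply: (@le_trans _ _ (\sum_(j < m) (s j `^ r * rnorm (Tstar (f j) (x j)) + e / m.+1%:R))).
  apply: ler_sum => j _.
  apply: (@le_trans _ _ (s j `^ r * (rnorm (Tstar (f j) (x j)) + e / m.+1%:R))).
    by rewrite ler_wpM2l ?powR_ge0// -lerBlDr (xP j).2.
  by rewrite mulrDr lerD2l ler_piMl ?(ltW e'0).
rewrite big_split /= lerD//.
  apply: le_trans h; apply: ler_sum => j _.
  have -> : f j (induced_seq T (fun j => to_scalars (s j `^ r) *: x j) j) =
      to_scalars (s j `^ r) * Tstar (f j) (x j).
    by rewrite /induced_seq linearZ dualZ.
  by rewrite rnormM rnorm_to_scalars ger0_norm ?powR_ge0.
rewrite sumr_const card_ord -[leLHS]mulr_natr mulrAC ler_pdivrMr ?ltr0n//.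
by rewrite ler_wpM2l ?(ltW e0)// ler_nat.
Qed.

Lemma mid_bounded0 (V : normedModType K) m c : mid_bounded p m (0 : nat -> V) c.
Proof.
move=> f _ N; rewrite big1 ?powR_ge0// => n _; rewrite big1// => j _.
by rewrite linear0 rnorm0 powR0 ?gt_eqF.
Qed.

Lemma ell_mid0 (V : normedModType K) : seq_ball (ell_mid p V) 0.
Proof. by apply/(ell_mid_ballP p1) => m; exact: mid_bounded0. Qed.

Lemma ell_conj0 (V : normedModType K) : seq_ball (ell q V) 0.
Proof.
have n1 : (ell_norm q (0%R : V^nat) <= 1%:E)%E.
  apply/(ell_conj_norm_leP p1 _ ltr01); exists (fun=> 0).
    by split=> // N; rewrite big1.
  by move=> j; rewrite rnorm0 mulr_ge0 ?powR_ge0.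
by split=> //; exact: le_lt_trans n1 (ltry _).
Qed.

Lemma ell_mid_dual_norm_ge0 (V : normedModType K) (z : V^nat) :
  (0 <= seq_norm (ell_mid_dual p V) z)%E.
Proof.
apply: (@le_trans _ _ (pairing_sum z (0%R : (dual V)^nat))).
  by apply: nneseries_ge0 => j _ _; rewrite lee_fin rnorm_ge0.
by apply: ereal_sup_ubound; exists 0 => //; exact: ell_mid0.
Qed.

Lemma induced_norm_ge0 (U V : normedModType K) (S : seq_space U) (S' : seq_space V)
    (A : {linear U -> V}) : seq_ball S 0 -> (forall z, (0 <= seq_norm S' z)%E) ->
  (0 <= induced_norm S S' A)%E.
Proof.
move=> S0 S'0; apply: le_trans (S'0 (induced_seq A 0)) _.
by apply: ereal_sup_ubound; exists 0.
Qed.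

Lemma mid_summingP (U V : normedModType K) (A : {linear U -> V}) :
  mid_summing p A <-> exists2 B, 0 < B & (mid_summing_norm p A <= B%:E)%E.
Proof.
apply: induced_bounded.
- exact: ell_mid_homogeneous.
- exact: ell_homogeneous.
- exact: ell_mid_finite_norm.
- by move=> z c c0 zc; apply/ell_finite_norm; exists c.
- exact: (ell_mid0 U).1.
Qed.

Lemma induced_dualP (U V : normedModType K) (A : {linear U -> V}) :
  induced_well_defined (ell q U) (ell_mid_dual p V) A /\
  induced_continuous (ell q U) (ell_mid_dual p V) A <->
  exists2 B, 0 < B & (induced_norm (ell q U) (ell_mid_dual p V) A <= B%:E)%E.
Proof.
apply: induced_bounded.
- exact: ell_conj_homogeneous.
- exact: ell_mid_dual_homogeneous.
- exact: ell_finite_norm.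
- exact: ell_mid_dual_of_norm.
- exact: (ell_conj0 U).1.
Qed.

Lemma mid_summing_norm_ge0 (U V : normedModType K) (A : {linear U -> V}) :
  (0 <= mid_summing_norm p A)%E.
Proof. by apply: induced_norm_ge0 => [|z]; [exact: ell_mid0|exact: Lnorm_ge0]. Qed.

Lemma mid_summing_norm_adjoint :
  mid_summing_norm p T = induced_norm (ell q (dual Y)) (ell_mid_dual p (dual X)) Tstar.
Proof.
apply: eq_ereal_by_bounds.
- exact: mid_summing_norm_ge0.
- by apply: induced_norm_ge0; [exact: ell_conj0|exact: ell_mid_dual_norm_ge0].
- by move=> C C0; split; [exact: adjoint_induced_le|exact: mid_summing_le_adjoint].
Qed.

Lemma adjoint_mid_summing_norm :
  mid_summing_norm p Tstar = induced_norm (ell q X) (ell_mid_dual p Y) T.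
Proof.
apply: eq_ereal_by_bounds.
- exact: mid_summing_norm_ge0.
- by apply: induced_norm_ge0; [exact: ell_conj0|exact: ell_mid_dual_norm_ge0].
- by move=> C C0; split; [exact: induced_le_adjoint_mid|exact: adjoint_mid_le_induced].
Qed.

End duality.

Unset Implicit Arguments.
Set Strict Implicit.
Set Printing Implicit Defensive.

Theorem theorem3p11 (R : realType) (k : base_field)
    (X Y : completeNormedModType (scalars R k))
    (T : {linear X -> Y}) (cT : continuous T) (p : R) (p1 : 1 <= p) :
  let q := hoelder_conjugate p%:E in
  let Tstar : {linear dual Y -> dual X} := adjoint cT in
  ((induced_well_defined (ell q (dual Y)) (ell_mid_dual p (dual X)) Tstar /\
    induced_continuous (ell q (dual Y)) (ell_mid_dual p (dual X)) Tstar
      <-> mid_summing p T) /\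
   (mid_summing p T -> mid_summing_norm p T =
      induced_norm (ell q (dual Y)) (ell_mid_dual p (dual X)) Tstar)) /\
  ((induced_well_defined (ell q X) (ell_mid_dual p Y) T /\
    induced_continuous (ell q X) (ell_mid_dual p Y) T
      <-> mid_summing p Tstar) /\
   (mid_summing p Tstar -> mid_summing_norm p Tstar =
      induced_norm (ell q X) (ell_mid_dual p Y) T)).
Proof.
move=> q Tstar; split; split.
- by rewrite mid_summingP// induced_dualP// mid_summing_norm_adjoint.
- by move=> _; exact: mid_summing_norm_adjoint.
- by rewrite mid_summingP// induced_dualP// adjoint_mid_summing_norm.
- by move=> _; exact: adjoint_mid_summing_norm.
Qed.
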